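(* Let $c \in [1/4,1/2)$. Then $c$ is the threshold for diameter 2 for the family of groups $(S_n \times C_{m_n})_{n}$, where $S_n$ is the symmetric group on $n$ letters, $C_m$ is the cyclic group of order $m$, and $m_n = \lfloor (n!)^{\frac{2c}{1-2c}} \rfloor$.
   Context: For a finite group $G$ and a subset $S \subseteq G$, the Cayley graph $\Gamma(G;S)$ has vertex set $G$ and an edge between distinct $g,h$ if and only if $hg^{-1} \in S$ or $gh^{-1} \in S$ (loops and multiple edges are ignored). The random model $\mathcal{G}(G,p)$ is the probability space of graphs $\Gamma(G;S)$ where each element of $G$ is put in $S$ independently with probability $p$. The diameter of a disconnected graph is taken to be infinite. Let $(G_k)$ be a family of finite groups of orders $n_k$ with $n_k \to \infty$. A real $c>0$ is the threshold for diameter 2 for $(G_k)$ if for every $\varepsilon>0$, with probability tending to $1$ as $k\to\infty$, $\Gamma \in \mathcal{G}(G_k,p)$ has diameter greater than 2 if $p \leqslant \sqrt{(c-\varepsilon)\frac{\log n_k}{n_k}}$ and has diameter at most 2 if $p \geqslant \sqrt{(c+\varepsilon)\frac{\log n_k}{n_k}}$. *)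

(* Defs.v *)
From HB Require Import structures.
From mathcomp Require Import all_boot all_order all_algebra all_fingroup.
From mathcomp Require Import all_solvable.
From mathcomp Require Import all_classical all_reals all_analysis.

Set Implicit Arguments.
Unset Strict Implicit.
Unset Printing Implicit Defensive.

Import Order.TTheory GRing.Theory Num.Theory.
Import numFieldNormedType.Exports.

Local Open Scope classical_set_scope.
Local Open Scope ring_scope.

Section Graphs.
Context (R : realType) (T : finType).

(* [path e x s] has [size s] edges; the infimum of the empty set is +oo, so
   vertices in different components are at distance +oo. *)
Definition gdist (e : rel T) (x y : T) : \bar R :=
  ereal_inf [set ((size s)%:R)%:E | s in [set s | path e x s /\ last x s = y]].

Definition diameter (e : rel T) : \bar R :=
  ereal_sup [set gdist e xy.1 xy.2 | xy in [set: T * T]].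

End Graphs.

Definition cayley (gT : finGroupType) (S : {set gT}) : rel gT :=
  fun g h => (g != h) && ((h * g^-1 \in S)%g || (g * h^-1 \in S)%g).

(* Probability that a random subset of [gT], containing each element
   independently with probability [p], satisfies [E]. *)
Definition random_subset_prob (R : realType) (gT : finGroupType) (p : R)
    (E : pred {set gT}) : R :=
  \sum_(S : {set gT} | E S) \prod_(g : gT) (if g \in S then p else 1 - p).

(* The edge probability is an arbitrary sequence [p] obeying the stated bound
   for all large [k]. [Num.sqrt] is 0 on negative reals, so the first bound
   reads [p k = 0] when [c <= eps]. *)
Definition diameter2_threshold (R : realType) (G : nat -> finGroupType)
    (c : R) : Prop :=
  let n k : R := #|G k|%:R in
  [/\ 0 < c,
      n k @[k --> \oo] --> +oo &
      forall eps : R, 0 < eps ->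
      forall p : nat -> R, (forall k, 0 <= p k <= 1) ->
        ((\forall k \near \oo, p k <= Num.sqrt ((c - eps) * (ln (n k) / n k))) ->
          random_subset_prob (p k)
            (fun S : {set G k} => 2%:E < diameter R (cayley S))%E
            @[k --> \oo] --> (1 : R)) /\
        ((\forall k \near \oo, Num.sqrt ((c + eps) * (ln (n k) / n k)) <= p k) ->
          random_subset_prob (p k)
            (fun S : {set G k} => diameter R (cayley S) <= 2%:E)%E
            @[k --> \oo] --> (1 : R))].

Definition cyc_order (R : realType) (c : R) (n : nat) : nat :=
  Num.truncn ((n`!)%:R `^ (2 * c / (1 - 2 * c))).

(* ['I_m.-1.+1] is the additive group of integers mod [m] for every [m > 0],
   including [m = 1] (unlike ['Z_m]); for [1/4 <= c < 1/2] the exponent is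
   at least 1, so [cyc_order c n >= n`! > 0]. *)
Definition sym_cyc (R : realType) (c : R) (n : nat) : finGroupType :=
  ('S_n * 'I_(cyc_order c n).-1.+1)%type.

(* Main.v *)
Require Import Defs.
From HB Require Import structures.
From mathcomp Require Import all_boot all_order all_algebra all_fingroup.
From mathcomp Require Import all_solvable.
From mathcomp Require Import all_classical all_reals all_analysis.
From mathcomp Require Import fintype finset.
From mathcomp Require Import ring lra zify.

Set Implicit Arguments.
Unset Strict Implicit.
Unset Printing Implicit Defensive.

Import Order.TTheory GRing.Theory Num.Theory.
Local Open Scope ring_scope.

(** Write [N] for the order of [G = S_n x C_m] and [L] for [ln N]. For [g != 1],
    the points [x] and [g x] are at distance more than 2 iff the random set [S] is
    independent in a graph [H_g] on [G] joining [a] to the elements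
    [g^+-1 a^+-1] and [a^+-1 g^+-1]. This graph has bounded degree, and revealing
    [S] one vertex at a time shows that [S] is independent with probability
    [exp (- p^2 e(H_g) (1 + o(1)))], where [e] counts edges.

    For [g = (sigma, t)] almost every degree of [H_g] is at least 8 if
    [sigma != 1] and [t^2 != 1], 4 if exactly one of these fails, and 2 if both
    fail: further coincidences among neighbours force [a] to centralise [sigma],
    which concerns at most [N / (n - 1)] elements, or prescribe the square of the
    [C_m]-coordinate of [a], which concerns [O(n!)] elements. With
    [p^2 = c' L / N] the corresponding probabilities are at most about
    [N^(-4c')], [N^(-2c')] and [N^(-c')]. There are about
    [N^(2c)] elements [g] with [sigma = 1] and [N^(1 - 2c)] with [t^2 = 1], so the
    union bound tends to 0 as soon as [c' > c]. When [c' < c], the expected number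
    of central [g = (1, t)] at distance more than 2 from [1] tends to infinity,
    and the second moment method applies because the graphs of [(1, t)] and
    [(1, t')] are nearly edge-disjoint for [t' != t^+-1]. *)

(** * Random subsets *)

Lemma finset_ind (T : finType) (P : {set T} -> Prop) :
  P set0 -> (forall v (A : {set T}), v \notin A -> P A -> P (v |: A)) -> forall A, P A.
Proof.
move=> P0 PU A; elim: {A}#|A| {-2}A (erefl #|A|) => [A /cards0_eq -> //|k IHk A].
move=> cA; have /card_gt0P [v vA] : (0 < #|A|)%N by rewrite cA.
rewrite -(setD1K vA); apply: PU; first by rewrite !inE eqxx.
by apply: IHk; move: cA; rewrite (cardsD1 v) vA => -[].
Qed.

Section RandomSubset.
Context {R : realFieldType} {T : finType}.
Implicit Types (A B S : {set T}) (f h : {set T} -> R) (q : R).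

(** The expectation of [f S] for a random [S] inside [A] that keeps each element independently with
    probability [q]. The ground set [A] is a parameter so that elements can be revealed one at a
    time. *)
Definition subset_mean q A f : R :=
  \sum_(S : {set T} | S \subset A) q ^+ #|S| * (1 - q) ^+ #|A :\: S| * f S.

Lemma subset_mean0 q f : subset_mean q set0 f = f set0.
Proof.
rewrite /subset_mean (eq_bigl (pred1 set0)) => [|S]; last by rewrite subset0.
by rewrite big_pred1_eq setD0 cards0 !expr0 !mul1r.
Qed.

(** Condition on whether [v] is selected. The inductions over the ground set below all rest on this
    recursion. *)
Lemma subset_meanU1 q A v f : v \notin A ->
  subset_mean q (v |: A) f =
  (1 - q) * subset_mean q A f + q * subset_mean q A (fun S => f (v |: S)).
Proof.
move=> vA; rewrite /subset_mean (bigID (fun S => v \in S)) /= addrC.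
congr (_ + _).
  rewrite mulr_sumr; apply: eq_big => S.
    by rewrite -subsetD1 setU1K.
  rewrite -subsetD1 setU1K // => SA.
  have vS : v \notin S by apply: contra vA; apply: (subsetP SA).
  have -> : #|(v |: A) :\: S| = #|A :\: S|.+1.
    by rewrite setDUl (setDidPl _) ?disjoints1 // cardsU1 inE (negbTE vA) andbF.
  rewrite exprS; ring.
rewrite mulr_sumr (reindex_onto (fun S => v |: S) (fun S => S :\ v)) /=; last first.
  by move=> S /andP[_ vS]; rewrite setD1K.
apply: eq_big => S.
  rewrite setU11 andbT; apply/andP/idP => [[SA /eqP <-]|SA].
    by rewrite subDset.
  have vS : v \notin S by apply: contra vA; apply: (subsetP SA).
  by rewrite setU1K // setUS.
move=> /andP[/andP[SA _] /eqP SE].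
have vS : v \notin S by rewrite -SE !inE eqxx.
rewrite cardsU1 vS /= add1n exprS.
have -> : (v |: A) :\: (v |: S) = A :\: S.
  apply/setP => x; rewrite !inE; case: (eqVneq x v) => //= ->.
  by rewrite (negbTE vA) andbF.
ring.
Qed.

Lemma subset_mean_setT q f :
  \sum_(S : {set T}) (\prod_(g : T) (if g \in S then q else 1 - q)) * f S =
  subset_mean q [set: T] f.
Proof.
rewrite /subset_mean; apply: eq_big => [S|S _]; first by rewrite subsetT.
congr (_ * _); rewrite (bigID (mem S)) /=; congr (_ * _).
  by rewrite (eq_bigr (fun=> q)) ?prodr_const // => i ->.
rewrite (eq_bigr (fun=> 1 - q)) => [|i /negbTE -> //].
by rewrite prodr_const; congr (_ ^+ _); apply: eq_card => x; rewrite !inE andbT.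
Qed.

Lemma eq_subset_mean q A f h :
  (forall S, S \subset A -> f S = h S) -> subset_mean q A f = subset_mean q A h.
Proof. by move=> fh; apply: eq_bigr => S /fh ->. Qed.

Lemma subset_mean_cst q A (a : R) : subset_mean q A (fun=> a) = a.
Proof.
elim/finset_ind: A => [|v A vA IHA]; first by rewrite subset_mean0.
by rewrite subset_meanU1 // IHA; ring.
Qed.

Lemma subset_meanD q A f h :
  subset_mean q A (fun S => f S + h S) = subset_mean q A f + subset_mean q A h.
Proof. by rewrite -big_split; apply: eq_bigr => S _; rewrite mulrDr. Qed.

Lemma subset_meanZ q A (a : R) f :
  subset_mean q A (fun S => a * f S) = a * subset_mean q A f.
Proof. by rewrite mulr_sumr; apply: eq_bigr => S _; rewrite mulrCA. Qed.

Lemma subset_mean_sum q A (I : finType) (P : pred I) (F : I -> {set T} -> R) :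
  subset_mean q A (fun S => \sum_(i | P i) F i S) =
  \sum_(i | P i) subset_mean q A (F i).
Proof.
by rewrite /subset_mean exchange_big; apply: eq_bigr => S _; rewrite mulr_sumr.
Qed.

Lemma ler_subset_mean q A f h : 0 <= q <= 1 ->
  (forall S, S \subset A -> f S <= h S) ->
  subset_mean q A f <= subset_mean q A h.
Proof.
move=> /andP[q0 q1] fh; apply: ler_sum => S SA; apply: ler_wpM2l (fh S SA).
by rewrite mulr_ge0 ?exprn_ge0 // subr_ge0.
Qed.

(** Revealing [v] writes the mean as a mixture of two means with weights [1 - q] and [q]. Both are
    antitone by induction, and the one with [v] selected is the smaller, so moving weight to it
    lowers the mixture. *)
Lemma subset_mean_antitone q q' A f : 0 <= q -> q <= q' -> q' <= 1 ->
  (forall S S', S \subset S' -> f S' <= f S) ->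
  subset_mean q' A f <= subset_mean q A f.
Proof.
move=> q0 qq' q'1; elim/finset_ind: A f => [|v A vA IHA] f fA.
  by rewrite !subset_mean0.
rewrite !subset_meanU1 //.
have fvA S S' : S \subset S' -> f (v |: S') <= f (v |: S).
  by move=> SS'; apply: fA; apply: setUS.
have H1 := IHA _ fA; have H2 := IHA _ fvA.
have H3 : subset_mean q A (fun S => f (v |: S)) <= subset_mean q A f.
  by apply: ler_subset_mean => [|S _]; [lra | apply: fA; apply: subsetU1].
nra.
Qed.

(** Avoiding [B] has probability [(1 - q) ^+ #|B|], and by independence what remains is a fresh
    random subset of [A :\: B]. *)
Lemma subset_mean_avoid q A B f : B \subset A ->
  subset_mean q A (fun S => [disjoint S & B]%:R * f S) =
  (1 - q) ^+ #|B| * subset_mean q (A :\: B) f.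
Proof.
move=> BA; rewrite /subset_mean (bigID (fun S => [disjoint S & B])) /=.
rewrite [X in _ + X]big1 ?addr0 => [|S /andP[_ /negbTE ->]]; last first.
  by rewrite mul0r mulr0.
rewrite mulr_sumr; apply: eq_big => S; first by rewrite subsetD.
move=> /andP[SA SB]; rewrite SB mul1r.
have -> : #|A :\: S| = (#|B| + #|(A :\: B) :\: S|)%N.
  rewrite !cardsDS //; last by rewrite subsetD SA.
  have := subset_leq_card SA; have := subset_leq_card BA.
  have : (#|S| <= #|A :\: B|)%N by apply: subset_leq_card; rewrite subsetD SA.
  rewrite cardsDS //; lia.
rewrite exprD; ring.
Qed.

End RandomSubset.

(** * Probability that a random subset is independent *)

Lemma bernoulli_ler (R : realFieldType) (x : R) k : 0 <= x <= 1 ->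
  1 - k%:R * x <= (1 - x) ^+ k.
Proof.
move=> x01; elim: k => [|k IHk]; first by rewrite mul0r subr0 expr0.
have : 0 <= k%:R :> R by [].
rewrite exprS -natr1; nra.
Qed.

(** A crude second Bonferroni inequality: the coefficient 1 of the square, in place of 1/2, leaves
    an induction step whose slack is a sum of nonnegative terms. *)
Lemma bonferroni_ler (R : realFieldType) (x : R) k : 0 <= x <= 1 ->
  (1 - x) ^+ k <= 1 - k%:R * x + (k%:R * x) ^+ 2.
Proof.
move=> x01; elim: k => [|k IHk]; first by rewrite mul0r subr0 expr0n addr0.
have k0 : 0 <= k%:R :> R by [].
have : (1 - x) * (1 - x) ^+ k <= (1 - x) * (1 - k%:R * x + (k%:R * x) ^+ 2).
  by apply: ler_wpM2l => //; lra.
move=> H; rewrite exprS; apply: le_trans H _; rewrite -natr1 -subr_ge0.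
rewrite [leRHS](_ : _ = (k%:R + 1) * x ^+ 2 + k%:R ^+ 2 * x ^+ 3); last by ring.
by rewrite addr_ge0 ?mulr_ge0 ?exprn_ge0 //; lra.
Qed.

Section HardCore.
Context {R : realType} {T : finType}.
Implicit Types (A B S : {set T}) (e : rel T) (q : R).

(* The relation may have loops: a vertex with [e a a] is in no independent set. *)
Definition independent e S := [forall a in S, forall b in S, ~~ e a b].

Definition indep_prob q e A : R :=
  subset_mean q A (fun S => (independent e S)%:R).

(** The vertex itself is left out, since a loop costs a factor [1 - q] and is accounted for apart
    from the edges. *)
Definition nbrs e v : {set T} := [set b | (b != v) && e v b].

(** For symmetric [e] this is twice the number of edges inside [A], hence the halves in the
    exponents below. *)
Definition arcs e A : nat := \sum_(a in A) #|nbrs e a :&: A|.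

Lemma independentP e S :
  reflect {in S &, forall a b, ~~ e a b} (independent e S).
Proof.
apply: (iffP forall_inP) => [H a b /H /forall_inP Ha /Ha //|H a aS].
by apply/forall_inP => b; apply: H.
Qed.

Lemma independent_subset e S S' :
  S \subset S' -> independent e S' -> independent e S.
Proof.
move=> /subsetP SS' /independentP H; apply/independentP => a b /SS' aS /SS'.
exact: H.
Qed.

Lemma independent_antitone e S S' : S \subset S' ->
  (independent e S')%:R <= (independent e S)%:R :> R.
Proof.
move=> /(@independent_subset e); rewrite ler_nat.
by case: (independent e S') => // ->.
Qed.

Lemma independent0 e : independent e set0.
Proof. by apply/independentP => a b; rewrite inE. Qed.

Lemma independentU1_loop e v S : e v v -> independent e (v |: S) = false.
Proof.
by move=> evv; apply/independentP => /(_ v v (setU11 _ _) (setU11 _ _)) /negP.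
Qed.

Lemma independentU1 e v A S : symmetric e -> v \notin A -> ~~ e v v ->
  S \subset A ->
  independent e (v |: S) = [disjoint S & nbrs e v :&: A] && independent e S.
Proof.
move=> esym vA evv SA; apply/idP/andP => [H|[dS /independentP H]].
  split; last exact: independent_subset (subsetU1 _ _) H.
  rewrite disjoint_subset; apply/subsetP => x xS; rewrite !inE.
  move/independentP: H => /(_ v x (setU11 _ _) (setU1r _ xS)) /negbTE ->.
  by rewrite andbF.
have vS x : x \in S -> ~~ e v x.
  move=> xS; apply: contraTN dS => evx; apply/pred0Pn; exists x => /=.
  rewrite !inE xS evx (subsetP SA) // !andbT.
  by apply: contraNneq vA => <-; apply: (subsetP SA).
apply/independentP => a b /setU1P[->|aS] /setU1P[->|bS] //.
- exact: vS.
- by rewrite esym vS.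
- exact: H.
Qed.

Lemma indep_prob_ge0 q e A : 0 <= q <= 1 -> 0 <= indep_prob q e A.
Proof.
move=> q01; rewrite -(subset_mean_cst q A 0).
by apply: ler_subset_mean => // S _; rewrite ler0n.
Qed.

Lemma indep_prob0 q e : indep_prob q e set0 = 1.
Proof. by rewrite /indep_prob subset_mean0 independent0. Qed.

Lemma indep_probU1_le q e v A : 0 <= q <= 1 -> v \notin A ->
  indep_prob q e (v |: A) <= indep_prob q e A.
Proof.
move=> q01 vA; rewrite /indep_prob subset_meanU1 //.
have : subset_mean q A (fun S => (independent e (v |: S))%:R) <=
       subset_mean q A (fun S => (independent e S)%:R).
  by apply: ler_subset_mean => // S _; apply/independent_antitone/subsetU1.
nra.
Qed.

Lemma indep_prob_setD q e A B : 0 <= q <= 1 ->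
  indep_prob q e A <= indep_prob q e (A :\: B).
Proof.
move=> q01; elim/finset_ind: B => [|v B vB IHB]; first by rewrite setD0.
rewrite setUC -setDDl; apply: le_trans IHB _.
case: (boolP (v \in A :\: B)) => vAB;
  last first.
  have -> : (A :\: B) :\ v = A :\: B by apply/setDidPl; rewrite disjoint_sym disjoints1.
  exact: lexx.
by rewrite -{1}(setD1K vAB) indep_probU1_le // !inE eqxx.
Qed.

Lemma indep_probU1_loop q e v A : v \notin A -> e v v ->
  indep_prob q e (v |: A) = (1 - q) * indep_prob q e A.
Proof.
move=> vA evv; rewrite /indep_prob subset_meanU1 //.
rewrite [X in _ + q * X](_ : _ = 0) ?mulr0 ?addr0 //.
rewrite -(subset_mean_cst q A 0); apply: eq_subset_mean => S _.
by rewrite independentU1_loop.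
Qed.

(** If [v] is selected, all its neighbours in [A] must be avoided, and the rest has to be
    independent in [A] without them. *)
Lemma indep_probU1 q e v A : symmetric e -> v \notin A -> ~~ e v v ->
  let N := nbrs e v :&: A in
  indep_prob q e (v |: A) =
  (1 - q) * indep_prob q e A + q * ((1 - q) ^+ #|N| * indep_prob q e (A :\: N)).
Proof.
move=> esym vA evv N; rewrite /indep_prob subset_meanU1 //; congr (_ + q * _).
rewrite -subset_mean_avoid ?subsetIr //; apply: eq_subset_mean => S SA.
by rewrite (independentU1 esym vA evv SA); case: [disjoint _ & _]; rewrite ?mul1r ?mul0r.
Qed.

Lemma indep_probU1_ge q e v A : 0 <= q <= 1 -> symmetric e -> v \notin A ->
  ~~ e v v ->
  (1 - q + q * (1 - q) ^+ #|nbrs e v :&: A|) * indep_prob q e A <=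
  indep_prob q e (v |: A).
Proof.
move=> q01 esym vA evv; rewrite indep_probU1 // mulrDl lerD2l -mulrA.
have /andP[q0 q1] := q01.
apply: ler_wpM2l => //; apply: ler_wpM2l; first by rewrite exprn_ge0 ?subr_ge0.
exact: indep_prob_setD.
Qed.

Lemma indep_probU1_ge_lin q e v A : 0 <= q <= 1 -> symmetric e -> v \notin A ->
  ~~ e v v ->
  (1 - #|nbrs e v :&: A|%:R * q ^+ 2) * indep_prob q e A <=
  indep_prob q e (v |: A).
Proof.
move=> q01 esym vA evv; apply: le_trans (indep_probU1_ge q01 esym vA evv).
apply: ler_wpM2r; first exact: indep_prob_ge0.
have := bernoulli_ler #|nbrs e v :&: A| q01; nra.
Qed.

(** The vertices of [B] are restored one at a time; each multiplies the probability by at least the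
    factor of [indep_probU1_ge], in which the degree may be replaced by the maximum [d]. *)
Lemma indep_prob_setD_ge q e A B d : 0 <= q <= 1 -> symmetric e ->
  (forall v, (#|nbrs e v| <= d)%N) -> B \subset A -> {in B, forall v, ~~ e v v} ->
  (1 - q + q * (1 - q) ^+ d) ^+ #|B| * indep_prob q e (A :\: B) <=
  indep_prob q e A.
Proof.
move=> q01 esym deg; have /andP[q0 q1] := q01.
have r0 : 0 <= 1 - q + q * (1 - q) ^+ d.
  by rewrite addr_ge0 ?subr_ge0 // mulr_ge0 // exprn_ge0 // subr_ge0.
elim/finset_ind: B => [|v B vB IHB] BA Bl.
  by rewrite setD0 cards0 mul1r.
have := IHB (subset_trans (subsetU1 _ _) BA) (fun x xB => Bl x (setU1r _ xB)).
apply: le_trans; rewrite cardsU1 vB add1n exprSr -mulrA.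
apply: ler_wpM2l; first by rewrite exprn_ge0.
have vA : v \in A :\: B by rewrite inE vB (subsetP BA) // setU11.
rewrite setUC -setDDl -{2}(setD1K vA).
have vA' : v \notin (A :\: B) :\ v by rewrite !inE eqxx.
apply: le_trans (indep_probU1_ge q01 esym vA' (Bl v (setU11 _ _))).
apply: ler_wpM2r; first exact: indep_prob_ge0.
rewrite lerD2l; apply: ler_wpM2l => //; apply: ler_wiXn2l; rewrite ?subr_ge0 //.
  by rewrite gerBl.
by apply: leq_trans (deg v); apply: subset_leq_card; apply: subsetIl.
Qed.

(* Given that [A] carries an independent set, each neighbour of [v] in [A] is
   selected with probability about [q]: deleting a neighbour [u] multiplies
   [indep_prob] by at most [(1 - q + q * (1 - q) ^+ d)^-1]. *)
Lemma indep_probU1_le_lin q e v A d : 0 <= q -> 2 * d%:R * q <= 1 -> q <= 1 ->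
  symmetric e -> (forall v, (#|nbrs e v| <= d)%N) -> v \notin A ->
  {in v |: A, forall a, ~~ e a a} ->
  indep_prob q e (v |: A) <=
  (1 - #|nbrs e v :&: A|%:R * (q ^+ 2 * (1 - 2 * d%:R * q))) * indep_prob q e A.
Proof.
move=> q0 dq q1 esym deg vA Al; have q01 : 0 <= q <= 1 by rewrite q0.
rewrite indep_probU1 ?Al ?setU11 //; set N := nbrs e v :&: A; set k := #|N|.
set z := indep_prob q e A; have z0 : 0 <= z by exact: indep_prob_ge0.
(* [r] bounds from below the factor for restoring one neighbour, and [y] bounds from below the
   conditional probability that a neighbour is selected. The inequality [qr] turns the cost [1 - q]
   of avoiding it, divided by [r], into at most [1 - y]. *)
pose y := q * (1 - d%:R * q); pose r := 1 - q + q * (1 - q) ^+ d.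
have d0 : 0 <= d%:R :> R by [].
have kd : k%:R <= d%:R :> R.
  by rewrite ler_nat (leq_trans _ (deg v)) // subset_leq_card // subsetIl.
have y01 : 0 <= y <= 1 by rewrite /y; nra.
have qr : 1 - q <= (1 - y) * r.
  have rge : 1 - d%:R * q ^+ 2 <= r by have := bernoulli_ler d q01; rewrite /r; nra.
  have : (1 - y) * (1 - d%:R * q ^+ 2) <= (1 - y) * r by apply: ler_wpM2l => //; lra.
  apply: le_trans.
  have -> : (1 - y) * (1 - d%:R * q ^+ 2) =
    1 - q + (d%:R * q) * (q ^+ 2 * (1 - d%:R * q)) by rewrite /y; ring.
  rewrite lerDl mulr_ge0 //; first exact: mulr_ge0.
  by rewrite mulr_ge0 ?sqr_ge0 //; lra.
have H1 : (1 - q) ^+ k * indep_prob q e (A :\: N) <= (1 - y) ^+ k * z.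
  have Nl : {in N, forall a, ~~ e a a}.
    by move=> a /setIP[_ aA]; apply: Al; apply: setU1r.
  have := indep_prob_setD_ge q01 esym deg (subsetIr _ _) Nl.
  rewrite -/r -/N -/k -/z => H.
  have : (1 - y) ^+ k * (r ^+ k * indep_prob q e (A :\: N)) <= (1 - y) ^+ k * z.
    by apply: ler_wpM2l H; apply: exprn_ge0; lra.
  apply: le_trans; rewrite mulrA -exprMn; apply: ler_wpM2r.
    exact: indep_prob_ge0.
  by apply: lerXn2r (qr); rewrite nnegrE; lra.
(* Since [k <= d], the quadratic Bonferroni term is at most [k q * d q], which is absorbed by
   passing from [d q] to [2 d q]. *)
have H2 : (1 - y) ^+ k <= 1 - k%:R * (q * (1 - 2 * d%:R * q)).
  apply: le_trans (bonferroni_ler k y01) _.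
  have k0 : 0 <= k%:R :> R by [].
  have dq2 : 0 <= d%:R * q * q by rewrite !mulr_ge0.
  have ky : k%:R * y <= d%:R * q.
    by apply: ler_pM => //; [lra | rewrite /y; lra].
  have : k%:R * y * (k%:R * y) <= k%:R * y * (d%:R * q).
    by apply: ler_wpM2l ky; apply: mulr_ge0 => //; lra.
  have : 0 <= k%:R * q * (d%:R * q * (d%:R * q)) by rewrite !mulr_ge0.
  rewrite expr2 /y; lra.
have H3 : (1 - y) ^+ k * z <= (1 - k%:R * (q * (1 - 2 * d%:R * q))) * z.
  exact: ler_wpM2r.
have : q * ((1 - q) ^+ k * indep_prob q e (A :\: N)) <=
  q * ((1 - k%:R * (q * (1 - 2 * d%:R * q))) * z).
  by apply: ler_wpM2l => //; apply: le_trans H3.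
nra.
Qed.

Lemma arcsU1 e v A : symmetric e -> v \notin A ->
  arcs e (v |: A) = (arcs e A + 2 * #|nbrs e v :&: A|)%N.
Proof.
move=> esym vA; rewrite /arcs big_setU1 //=.
have -> : nbrs e v :&: (v |: A) = nbrs e v :&: A.
  by apply/setP => x; rewrite !inE; case: eqVneq => //= ->.
have -> : (\sum_(a in A) #|nbrs e a :&: (v |: A)| =
           \sum_(a in A) ((v \in nbrs e a) + #|nbrs e a :&: A|))%N.
  apply: eq_bigr => a aA; rewrite setIUr cardsU.
  rewrite [X in (_ - X)%N](_ : _ = 0%N) ?subn0; last first.
    apply/eqP; rewrite cards_eq0 -subset0; apply/subsetP => x; rewrite !inE.
    by case/andP=> /andP[_ /eqP ->]; rewrite (negbTE vA) andbF.
  congr (_ + _)%N; case: (boolP (v \in nbrs e a)) => [va|va].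
    by rewrite (setIidPr _) ?cards1 // sub1set.
  apply/eqP; rewrite cards_eq0 -subset0; apply/subsetP => x; rewrite inE.
  by case/andP=> [xn /set1P xv]; rewrite xv (negbTE va) in xn.
rewrite big_split /= addnCA; set s := (\sum_(a in A) _)%N.
have -> : s = #|nbrs e v :&: A|.
  rewrite /s -big_mkcondr sum1_card; apply: eq_card => x.
  by rewrite !inE -topredE /= !inE esym eq_sym andbC.
lia.
Qed.

(** Each revealed vertex contributes one factor [1 - x <= expR (- x)], with [x] proportional to the
    number of its neighbours already revealed; these numbers add up to the number of edges, half of
    [arcs]. *)
Lemma indep_prob_le_expR q e A d : 0 <= q -> 2 * d%:R * q <= 1 -> q <= 1 ->
  symmetric e -> (forall v, (#|nbrs e v| <= d)%N) ->
  {in A, forall a, ~~ e a a} ->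
  indep_prob q e A <=
  expR (- (q ^+ 2 * (1 - 2 * d%:R * q) * (arcs e A)%:R / 2)).
Proof.
move=> q0 dq q1 esym deg.
elim/finset_ind: A => [|v A vA IHA] Al.
  by rewrite indep_prob0 /arcs big_set0 mulr0 mul0r oppr0 expR0.
have := IHA (fun a aA => Al a (setU1r _ aA)) => {}IHA.
apply: le_trans (indep_probU1_le_lin q0 dq q1 esym deg vA Al) _.
rewrite arcsU1 //; set k := #|_|; set w := q ^+ 2 * _.
have kw : 1 - k%:R * w <= expR (- (k%:R * w)) by apply: expR_ge1Dx.
have -> : - (w * (arcs e A + 2 * k)%:R / 2) =
  - (k%:R * w) + - (w * (arcs e A)%:R / 2) by rewrite natrD natrM; field.
rewrite expRD; apply: le_trans (ler_wpM2r _ kw) _.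
  by apply: indep_prob_ge0; rewrite q0.
by apply: ler_wpM2l => //; apply: expR_ge0.
Qed.

(** This is [1 + t <= expR t] at [t = x / (1 - x)], inverted. *)
Lemma expR_le_1B (x : R) : 0 <= x < 1 -> expR (- (x / (1 - x))) <= 1 - x.
Proof.
move=> /andP[x0 x1]; rewrite expRN -[leRHS]invrK lef_pV2 ?posrE ?expR_gt0 //.
  rewrite [leLHS](_ : _ = 1 + x / (1 - x)); last by field; lra.
  exact: expR_ge1Dx.
by rewrite invr_gt0; lra.
Qed.

(** The matching lower bound. A vertex with a loop contributes exactly [1 - q], any other vertex at
    least [1 - k q^2] with [k] its number of neighbours already revealed. *)
Lemma indep_prob_ge_expR q e A d : 0 <= q < 1 -> d%:R * q ^+ 2 < 1 ->
  symmetric e -> (forall v, (#|nbrs e v| <= d)%N) ->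
  expR (- (q / (1 - q) * #|[set a in A | e a a]|%:R +
           q ^+ 2 / (1 - d%:R * q ^+ 2) * (arcs e A)%:R / 2)) <=
  indep_prob q e A.
Proof.
move=> /andP[q0 q1] dq esym deg; have q01 : 0 <= q <= 1 by rewrite q0 ltW.
elim/finset_ind: A => [|v A vA IHA].
  rewrite indep_prob0 /arcs big_set0 mulr0 mul0r addr0 (_ : [set a in _ | _] = set0).
    by rewrite cards0 mulr0 oppr0 expR0.
  by apply/setP => x; rewrite !inE.
rewrite arcsU1 //; set k := #|nbrs e v :&: A|.
set w := q ^+ 2 / _ in IHA *.
have w0 : 0 <= w by rewrite /w divr_ge0 ?sqr_ge0 // subr_ge0 ltW.
have [evv|evv] := boolP (e v v).
  have -> : [set a in v |: A | e a a] = v |: [set a in A | e a a].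
    by apply/setP => x; rewrite !inE; case: eqVneq => // ->.
  rewrite cardsU1 inE (negbTE vA) /= indep_probU1_loop // natrD.
  have Hq : expR (- (q / (1 - q))) <= 1 - q by apply: expR_le_1B; rewrite q0.
  apply: le_trans (ler_wpM2l _ IHA); last by rewrite subr_ge0 ltW.
  apply: le_trans (ler_wpM2r (expR_ge0 _) Hq).
  rewrite -expRD ler_expR natrD natrM.
  have : 0 <= w * k%:R by rewrite mulr_ge0.
  lra.
have -> : [set a in v |: A | e a a] = [set a in A | e a a].
  by apply/setP => x; rewrite !inE; case: eqVneq => //= ->; rewrite (negbTE evv) andbF.
apply: le_trans (indep_probU1_ge_lin q01 esym vA evv).
have kd : k%:R <= d%:R :> R.
  by rewrite ler_nat (leq_trans _ (deg v)) // subset_leq_card // subsetIl.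
have x0 : 0 <= k%:R * q ^+ 2 by rewrite mulr_ge0 ?sqr_ge0.
have xd : k%:R * q ^+ 2 <= d%:R * q ^+ 2 by rewrite ler_wpM2r ?sqr_ge0.
apply: le_trans (ler_wpM2l _ IHA); last by rewrite -/k; lra.
have Hx : expR (- (k%:R * q ^+ 2 / (1 - k%:R * q ^+ 2))) <= 1 - k%:R * q ^+ 2.
  by apply: expR_le_1B; rewrite x0 /=; lra.
apply: le_trans (ler_wpM2r (expR_ge0 _) Hx).
rewrite -expRD ler_expR natrD natrM.
have : k%:R * q ^+ 2 / (1 - k%:R * q ^+ 2) <= k%:R * w.
  rewrite /w mulrA ler_wpM2l // lef_pV2 ?posrE; lra.
by lra.
Qed.

End HardCore.

(** * Two graphs at once, and the second moment *)

Section JointIndependence.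
Context {R : realType} {T : finType}.
Implicit Types (A B S : {set T}) (e : rel T) (q : R).

Lemma indep_probU1_ge_expR q e v A d : 0 <= q <= 1 -> d%:R * q ^+ 2 <= 1 / 2 ->
  symmetric e -> (#|nbrs e v| <= d)%N -> v \notin A -> ~~ e v v ->
  expR (- (2 * d%:R * q ^+ 2)) * indep_prob q e A <= indep_prob q e (v |: A).
Proof.
move=> q01 dq esym deg vA evv.
apply: le_trans (indep_probU1_ge_lin q01 esym vA evv).
apply: ler_wpM2r; first exact: indep_prob_ge0.
set k := #|_|; have kd : k%:R <= d%:R :> R.
  by rewrite ler_nat (leq_trans _ deg) // subset_leq_card // subsetIl.
have x0 : 0 <= k%:R * q ^+ 2 by rewrite mulr_ge0 ?sqr_ge0.
have xd : k%:R * q ^+ 2 <= d%:R * q ^+ 2 by rewrite ler_wpM2r ?sqr_ge0.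
apply: le_trans (expR_le_1B (x := k%:R * q ^+ 2) _); last by rewrite x0 /=; lra.
rewrite ler_expR lerN2 ler_pdivrMr; last lra.
nra.
Qed.

Variables (e1 e2 : rel T) (d : nat) (q : R).
Hypotheses (e1sym : symmetric e1) (e2sym : symmetric e2).
Let e12 : rel T := fun a b => e1 a b || e2 a b.
Hypothesis deg : forall v, (#|nbrs e12 v| <= d)%N.
Hypotheses (q0 : 0 <= q) (q2 : q <= 1 / 2) (dq : 2 * d%:R * q <= 1).

Let e12sym : symmetric e12.
Proof. by move=> a b; rewrite /e12 e1sym e2sym. Qed.

Let q01 : 0 <= q <= 1.
Proof.
have [hq0 hq2 hdq] : [/\ 0 <= q, q <= 1 / 2 & 2 * d%:R * q <= 1] by [].
lra.
Qed.

Let dq2 : d%:R * q ^+ 2 <= 1 / 2.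
Proof.
have [hq0 hq2 hdq] : [/\ 0 <= q, q <= 1 / 2 & 2 * d%:R * q <= 1] by [].
have : d%:R * q * q <= d%:R * q * 1 by rewrite ler_wpM2l ?mulr_ge0 //; lra.
by rewrite expr2; lra.
Qed.

Let nbrs12 v : nbrs e12 v = nbrs e1 v :|: nbrs e2 v.
Proof. by apply/setP => x; rewrite !inE -andb_orr. Qed.

Let deg1 v : (#|nbrs e1 v| <= d)%N.
Proof. by rewrite (leq_trans _ (deg v)) // subset_leq_card // nbrs12 subsetUl. Qed.

Let deg2 v : (#|nbrs e2 v| <= d)%N.
Proof. by rewrite (leq_trans _ (deg v)) // subset_leq_card // nbrs12 subsetUr. Qed.

Let X : {set T} := [set v | nbrs e1 v :&: nbrs e2 v != set0].

Let z12 A := indep_prob q e12 A.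
Let z1 A := indep_prob q e1 A.
Let z2 A := indep_prob q e2 A.

Let z12_ge0 A : 0 <= z12 A. Proof. exact: indep_prob_ge0. Qed.
Let z1_ge0 A : 0 <= z1 A. Proof. exact: indep_prob_ge0. Qed.
Let z2_ge0 A : 0 <= z2 A. Proof. exact: indep_prob_ge0. Qed.

(** The common induction step: [s] is the error exponent accumulated so far, and [s'] is what the
    new vertex adds when the union gains a factor at most [a] and the two graphs gain at least [b1]
    and [b2]. *)
Let joint_step (a b1 b2 s : R) A B : z12 A <= expR s * (z1 A * z2 A) ->
  0 <= a -> 0 <= b1 -> 0 <= b2 ->
  z12 B <= a * z12 A -> b1 * z1 A <= z1 B -> b2 * z2 A <= z2 B ->
  forall s' : R, a <= expR s' * (b1 * b2) ->
  z12 B <= expR (s' + s) * (z1 B * z2 B).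
Proof.
move=> IH a0 b10 b20 H12 H1 H2 s' Ha.
apply: le_trans H12 _; apply: le_trans (ler_wpM2l a0 IH) _.
have zz0 : 0 <= expR s * (z1 A * z2 A) by rewrite !mulr_ge0 ?expR_ge0.
apply: le_trans (ler_wpM2r zz0 Ha) _.
rewrite expRD -!mulrA; apply: ler_wpM2l; first exact: expR_ge0.
rewrite [leLHS](_ : _ = expR s * ((b1 * z1 A) * (b2 * z2 A))); last by ring.
apply: ler_wpM2l; first exact: expR_ge0.
by apply: ler_pM => //; apply: mulr_ge0.
Qed.

(* Adding a vertex outside [X] multiplies both sides by [1 - (k1 + k2) q^2] up to
   [O(q^3)], where [k1] and [k2] are its degrees into [A] in the two graphs. *)
Let joint_loopless A : {in A, forall a, ~~ e12 a a} ->
  z12 A <= expR (4 * d%:R ^+ 2 * q ^+ 3 * #|A|%:R + 4 * d%:R * q ^+ 2 * #|A :&: X|%:R)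
           * (z1 A * z2 A).
Proof.
have [hq0 hq2 hdq] : [/\ 0 <= q, q <= 1 / 2 & 2 * d%:R * q <= 1] by [].
have hdq2 : d%:R * q ^+ 2 <= 1 / 2 by [].
elim/finset_ind: A => [|v A vA IHA] Al.
  by rewrite set0I cards0 !mulr0 addr0 expR0 /z12 /z1 /z2 !indep_prob0 !mulr1.
have {}IHA := IHA (fun a aA => Al a (setU1r _ aA)).
have : ~~ e12 v v by apply: Al; apply: setU11.
rewrite /e12 negb_or => /andP[l1 l2].
have q30 : 0 <= d%:R ^+ 2 * q ^+ 3 by rewrite mulr_ge0 ?exprn_ge0.
have q20 : 0 <= d%:R * q ^+ 2 by rewrite mulr_ge0 ?exprn_ge0.
(* For [v] in [X] the degree in the union falls short of the sum of the two degrees. There the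
   trivial factor 1 is used for the union, and each single graph loses at most
   [expR (- (2 d q^2))]. *)
have [vX|vX] := boolP (v \in X).
  have -> : 4 * d%:R ^+ 2 * q ^+ 3 * #|v |: A|%:R +
     4 * d%:R * q ^+ 2 * #|(v |: A) :&: X|%:R =
     (4 * d%:R ^+ 2 * q ^+ 3 + 4 * d%:R * q ^+ 2) +
     (4 * d%:R ^+ 2 * q ^+ 3 * #|A|%:R + 4 * d%:R * q ^+ 2 * #|A :&: X|%:R).
    rewrite setIUl (setIidPl _) ?sub1set // !cardsU1 !inE (negbTE vA) /= !natrD.
    by ring.
  have E0 := expR_ge0 (- (2 * d%:R * q ^+ 2)).
  apply: (joint_step (a := 1) (b1 := expR (- (2 * d%:R * q ^+ 2)))
    (b2 := expR (- (2 * d%:R * q ^+ 2))) IHA) => //.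
  - by rewrite mul1r; apply: indep_probU1_le.
  - exact: indep_probU1_ge_expR.
  - exact: indep_probU1_ge_expR.
  - by rewrite -!expRD -[leLHS]expR0 ler_expR; lra.
have -> : 4 * d%:R ^+ 2 * q ^+ 3 * #|v |: A|%:R + 4 * d%:R * q ^+ 2 * #|(v |: A) :&: X|%:R =
     (4 * d%:R ^+ 2 * q ^+ 3) +
     (4 * d%:R ^+ 2 * q ^+ 3 * #|A|%:R + 4 * d%:R * q ^+ 2 * #|A :&: X|%:R).
  have -> : (v |: A) :&: X = A :&: X.
    apply/setP => x; rewrite !inE; case: eqVneq => //= ->.
    by rewrite !inE in vX; rewrite (negbTE vX) andbF.
  by rewrite cardsU1 vA /= natrD; ring.
set k1 := #|nbrs e1 v :&: A|; set k2 := #|nbrs e2 v :&: A|.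
have k12 : #|nbrs e12 v :&: A| = (k1 + k2)%N.
  rewrite nbrs12 setIUl cardsU [X in (_ - X)%N](_ : _ = 0%N) ?subn0 //.
  apply/eqP; rewrite cards_eq0 -subset0; move: vX; rewrite inE negbK => /eqP <-.
  by apply: setISS; apply: subsetIl.
have kd : k1%:R + k2%:R <= d%:R :> R.
  by rewrite -natrD -k12 ler_nat (leq_trans _ (deg v)) // subset_leq_card // subsetIl.
have k10 : 0 <= k1%:R :> R by []. have k20 : 0 <= k2%:R :> R by [].
have qq0 : 0 <= q ^+ 2 by rewrite sqr_ge0.
have x10 : 0 <= k1%:R * q ^+ 2 by rewrite mulr_ge0.
have x20 : 0 <= k2%:R * q ^+ 2 by rewrite mulr_ge0.
have xd : (k1%:R + k2%:R) * q ^+ 2 <= d%:R * q ^+ 2 by rewrite ler_wpM2r.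
have d0 : 0 <= d%:R :> R by [].
have dq0 : 0 <= d%:R * q by rewrite mulr_ge0.
apply: (joint_step (a := 1 - (k1 + k2)%:R * (q ^+ 2 * (1 - 2 * d%:R * q)))
  (b1 := 1 - k1%:R * q ^+ 2) (b2 := 1 - k2%:R * q ^+ 2) IHA).
- rewrite natrD; set x := (_ + _) in xd *.
  have : x * q ^+ 2 * (1 - 2 * d%:R * q) <= x * q ^+ 2 * 1.
    by rewrite ler_wpM2l ?mulr_ge0 // ?addr_ge0 //; lra.
  by lra.
- lra.
- lra.
- rewrite -k12; apply: indep_probU1_le_lin => //; lra.
- exact: indep_probU1_ge_lin.
- exact: indep_probU1_ge_lin.
set x := (k1%:R + k2%:R) * q ^+ 2 in xd *.
have Hx : 1 - x <= (1 - k1%:R * q ^+ 2) * (1 - k2%:R * q ^+ 2).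
  have : 0 <= k1%:R * q ^+ 2 * (k2%:R * q ^+ 2) by rewrite mulr_ge0.
  by rewrite /x; lra.
apply: le_trans (ler_wpM2l (expR_ge0 _) Hx).
have He : 1 + 4 * d%:R ^+ 2 * q ^+ 3 <= expR (4 * d%:R ^+ 2 * q ^+ 3) by exact: expR_ge1Dx.
apply: le_trans (ler_wpM2r _ He); last by lra.
have -> : 1 - (k1 + k2)%:R * (q ^+ 2 * (1 - 2 * d%:R * q)) = 1 - x + 2 * (d%:R * q) * x.
  by rewrite natrD /x; ring.
have : d%:R * q * x <= d%:R * q * (d%:R * q ^+ 2) by rewrite ler_wpM2l // mulr_ge0.
have -> : d%:R * q * (d%:R * q ^+ 2) = d%:R ^+ 2 * q ^+ 3 by ring.
nra.
Qed.

(** After the loopless vertices, the loops are added one by one. A loop of exactly one graph costs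
    [1 - q] on both sides, up to the edges of the other graph at that vertex. A loop of both costs
    [1 - q] on the left but its square on the right, which the factor [expR (2 * q)] repairs because
    [q <= 1/2]. *)
Lemma joint_indep_prob_le :
  indep_prob q e12 [set: T] <=
  expR (4 * d%:R ^+ 2 * q ^+ 3 * #|T|%:R +
        4 * d%:R * q ^+ 2 * (#|[set v | nbrs e1 v :&: nbrs e2 v != set0]| +
                             #|[set v | e1 v v || e2 v v]|)%:R +
        2 * q * #|[set v | e1 v v && e2 v v]|%:R) *
  (indep_prob q e1 [set: T] * indep_prob q e2 [set: T]).
Proof.
have [hq0 hq2 hdq] : [/\ 0 <= q, q <= 1 / 2 & 2 * d%:R * q <= 1] by [].
have hdq2 : d%:R * q ^+ 2 <= 1 / 2 by [].
pose L : {set T} := [set v | e12 v v]; pose D : {set T} := [set v | e1 v v && e2 v v].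
have q30 : 0 <= d%:R ^+ 2 * q ^+ 3 by rewrite mulr_ge0 ?exprn_ge0.
have q20 : 0 <= d%:R * q ^+ 2 by rewrite mulr_ge0 ?exprn_ge0.
suff H B : B \subset L ->
    z12 (~: L :|: B) <= expR (4 * d%:R ^+ 2 * q ^+ 3 * #|T|%:R +
       4 * d%:R * q ^+ 2 * #|X|%:R + 2 * d%:R * q ^+ 2 * #|B|%:R + 2 * q * #|B :&: D|%:R)
     * (z1 (~: L :|: B) * z2 (~: L :|: B)).
  have := H _ (subxx L); rewrite setUC setUCr => /le_trans; apply.
  apply: ler_wpM2r; first exact: mulr_ge0.
  have DL : D \subset L by apply/subsetP => x; rewrite !inE /e12 => /andP[->].
  rewrite ler_expR (setIidPr DL) natrD -/X -/L -/D.
  have : 0 <= d%:R * q ^+ 2 * #|L|%:R by rewrite mulr_ge0.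
  lra.
elim/finset_ind: B => [|v B vB IHB] BL.
  rewrite setU0 set0I cards0 !mulr0 !addr0; apply: le_trans (joint_loopless _) _.
    by move=> a; rewrite !inE.
  apply: ler_wpM2r; first exact: mulr_ge0.
  rewrite ler_expR; apply: lerD.
    by rewrite ler_wpM2l -?mulrA ?mulr_ge0 // ler_nat max_card.
  by rewrite ler_wpM2l -?mulrA ?mulr_ge0 // ler_nat subset_leq_card // subsetIr.
have {}IHB := IHB (subset_trans (subsetU1 _ _) BL).
have vL : v \in L by apply: (subsetP BL); apply: setU11.
rewrite setUCA; set A := ~: L :|: B in IHB *.
have vA : v \notin A by rewrite in_setU in_setC vL (negbTE vB).
rewrite cardsU1 vB /= natrD setIUl.
set s := (X in z12 A <= expR X * _) in IHB.
have q2e : 1 <= expR (2 * q) * (1 - q).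
  have := expR_ge1Dx (2 * q); nra.
have d2e : 0 <= 2 * d%:R * q ^+ 2 by lra.
have [vD|vD] := boolP (v \in D).
  have /andP[v1 v2] : e1 v v && e2 v v by rewrite inE in vD.
  rewrite (setIidPl _) ?sub1set // cardsU1 inE (negbTE vB) /= natrD.
  rewrite [X in expR X](_ : _ = (2 * d%:R * q ^+ 2 + 2 * q) + s); last by rewrite /s; ring.
  apply: (joint_step (a := 1 - q) (b1 := 1 - q) (b2 := 1 - q) IHB); try lra.
  - by rewrite /z12 indep_probU1_loop // /e12 v1.
  - by rewrite /z1 indep_probU1_loop.
  - by rewrite /z2 indep_probU1_loop.
  have : 1 <= expR (2 * d%:R * q ^+ 2) by rewrite -[leLHS]expR0 ler_expR.
  rewrite expRD; set E := expR (2 * d%:R * _); set E' := expR _ in q2e * => E1.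
  have : 1 * 1 <= E * (E' * (1 - q)) by apply: ler_pM.
  nra.
have -> : [set v] :&: D = set0.
  apply/setP => x; rewrite !inE; case: eqVneq => //= ->.
  by rewrite inE in vD; rewrite (negbTE vD).
rewrite set0U [X in expR X](_ : _ = 2 * d%:R * q ^+ 2 + s); last by rewrite /s; ring.
have H12 : z12 (v |: A) <= (1 - q) * z12 A.
  by rewrite /z12 indep_probU1_loop //; rewrite inE in vL.
have Ee : expR (2 * d%:R * q ^+ 2) * expR (- (2 * d%:R * q ^+ 2)) = 1.
  by rewrite -expRD subrr expR0.
have E0 := expR_ge0 (- (2 * d%:R * q ^+ 2)).
have [v1|v1] := boolP (e1 v v).
  have v2 : ~~ e2 v v by move: vD; rewrite inE v1.
  apply: (joint_step (a := 1 - q) (b1 := 1 - q)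
    (b2 := expR (- (2 * d%:R * q ^+ 2))) IHB) => //; try lra.
  - by rewrite /z1 indep_probU1_loop.
  - exact: indep_probU1_ge_expR.
  - by rewrite mulrCA Ee mulr1.
have v2 : e2 v v by move: vL; rewrite inE /e12 (negbTE v1).
apply: (joint_step (a := 1 - q) (b2 := 1 - q)
  (b1 := expR (- (2 * d%:R * q ^+ 2))) IHB) => //; try lra.
- exact: indep_probU1_ge_expR.
- by rewrite /z2 indep_probU1_loop.
- by rewrite mulrA Ee mul1r.
Qed.

End JointIndependence.

(* Chebyshev's inequality for the number of events that occur. *)
Lemma second_moment_subset_mean (R : realType) (T I : finType) (q delta : R)
    (A : {set T}) (J : {set I}) (b : I -> pred {set T}) :
  0 <= q <= 1 -> 0 <= delta ->
  let mu := \sum_(i in J) subset_mean q A (fun S => (b i S)%:R) in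
  0 < mu ->
  {in J &, forall i j, i != j -> subset_mean q A (fun S => (b i S && b j S)%:R) <=
    (1 + delta) * (subset_mean q A (fun S => (b i S)%:R) *
                   subset_mean q A (fun S => (b j S)%:R))} ->
  subset_mean q A (fun S => [forall i in J, ~~ b i S]%:R) <= mu^-1 + delta.
Proof.
move=> q01 delta0; set E := fun i => subset_mean q A (fun S => (b i S)%:R).
move=> mu mu0 pair; pose X S : R := \sum_(i in J) (b i S)%:R.
have E0 i : 0 <= E i.
  by rewrite -(subset_mean_cst q A 0); apply: ler_subset_mean => // S _.
have EX : subset_mean q A X = mu by rewrite subset_mean_sum.
have EX2 : subset_mean q A (fun S => X S * X S) <= mu + (1 + delta) * (mu * mu).
  rewrite (@eq_subset_mean _ _ q A _
    (fun S => \sum_(i in J) \sum_(j in J) (b i S && b j S)%:R)).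
    rewrite subset_mean_sum {1}/mu -/E big_distrlr /= mulr_sumr -big_split /=.
    apply: ler_sum => i iJ; rewrite subset_mean_sum (bigD1 i) //=; apply: lerD.
      by rewrite (@eq_subset_mean _ _ q A _ (fun S => (b i S)%:R)) // => S _; rewrite andbb.
    rewrite mulr_sumr [leRHS](bigD1 i) //= -[leLHS]add0r; apply: lerD.
      by apply: mulr_ge0; [lra | apply: mulr_ge0; apply: E0].
    by apply: ler_sum => j /andP[jJ ji]; apply: pair; rewrite // eq_sym.
  move=> S _; rewrite /X big_distrlr /=; apply: eq_bigr => i _; apply: eq_bigr => j _.
  by rewrite -natrM mulnb.
suff H : mu ^+ 2 * subset_mean q A (fun S => [forall i in J, ~~ b i S]%:R) <=
    mu + delta * mu ^+ 2.
  rewrite -(ler_pM2l (exprn_gt0 2 mu0)); apply: le_trans H _.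
  by rewrite mulrDr expr2 -mulrA divff ?gt_eqF // mulr1 (mulrC delta).
(* The integrand is [(X S - mu)^2]: it is nonnegative, and equals [mu^2] when no event occurs. *)
apply: (@le_trans _ _ (subset_mean q A (fun S => X S * X S + (- 2 * mu * X S + mu ^+ 2)))).
  rewrite -subset_meanZ; apply: ler_subset_mean => // S _.
  case: (boolP [forall i in J, _]) => [/forall_inP H|_].
    have -> : X S = 0 by apply: big1 => i /H /negbTE ->.
    by rewrite !mulr0 mulr1 !add0r.
  rewrite mulr0; have : 0 <= (X S - mu) ^+ 2 by rewrite sqr_ge0.
  by rewrite !expr2; lra.
rewrite !subset_meanD subset_meanZ EX subset_mean_cst expr2; lra.
Qed.

(** * Distance two in Cayley graphs *)

Section Cayley.
Context {gT : finGroupType}.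
Implicit Types (S : {set gT}) (g a b u v x y : gT).
Local Open Scope group_scope.

(* [x] and [g * x] are at distance more than 2 in the Cayley graph of [S] iff
   [S] is independent for this relation; the second disjunct and the solutions
   of [a * a = g] are loops. *)
Definition factor_rel g : rel gT := fun a b =>
  has (fun u => has (fun v => (u * v == g) || (v * u == g)) [:: b; b^-1])
      [:: a; a^-1]
  || (a == b) && ((a == g) || (a^-1 == g)).

Lemma factor_rel_sym g : symmetric (factor_rel g).
Proof.
move=> a b; rewrite /factor_rel /= !orbF; congr orb; last first.
  by case: eqVneq => [->|]; rewrite ?eqxx // eq_sym => /negbTE ->.
by case: (a * b == g); case: (b * a == g); case: (a * b^-1 == g);
   case: (b^-1 * a == g); case: (a^-1 * b == g); case: (b * a^-1 == g);
   case: (a^-1 * b^-1 == g); case: (b^-1 * a^-1 == g).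
Qed.

(** The eight equations of [factor_rel] solved for [b]; hence every degree is at most 8. *)
Definition factor_seq g a : seq gT :=
  [:: g * a; a * g; g^-1 * a; a * g^-1;
      g * a^-1; a^-1 * g; g^-1 * a^-1; a^-1 * g^-1].

Lemma factor_relE g a b :
  factor_rel g a b =
  (b \in factor_seq g a) || (a == b) && ((a == g) || (a^-1 == g)).
Proof.
congr orb; rewrite /= !orbF !inE.
(* Each candidate [c g] for [b] is turned back into an equation with right-hand side [g] by a map
   [h] that inverts [c]. *)
have E c h : (forall x y, x = c y <-> h x = y) -> (b == c g) = (h b == g).
  by move=> ch; apply/eqP/eqP => /ch.
pose rw := (invMg, invgK, mulgA, mulgK, mulgKV, mulVg, mulgV, mul1g, mulg1).
rewrite (E (fun y => y * a) (fun x => x * a^-1)); last first.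
  by move=> x y; split=> [->|<-]; rewrite !rw.
rewrite (E (fun y => a * y) (fun x => a^-1 * x)); last first.
  by move=> x y; split=> [->|<-]; rewrite !rw.
rewrite (E (fun y => y^-1 * a) (fun x => a * x^-1)); last first.
  by move=> x y; split=> [->|<-]; rewrite !rw.
rewrite (E (fun y => a * y^-1) (fun x => x^-1 * a)); last first.
  by move=> x y; split=> [->|<-]; rewrite !rw.
rewrite (E (fun y => y * a^-1) (fun x => x * a)); last first.
  by move=> x y; split=> [->|<-]; rewrite !rw.
rewrite (E (fun y => a^-1 * y) (fun x => a * x)); last first.
  by move=> x y; split=> [->|<-]; rewrite !rw.
rewrite (E (fun y => y^-1 * a^-1) (fun x => a^-1 * x^-1)); last first.
  by move=> x y; split=> [->|<-]; rewrite !rw.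
rewrite (E (fun y => a^-1 * y^-1) (fun x => x^-1 * a^-1)); last first.
  by move=> x y; split=> [->|<-]; rewrite !rw.
by case: (a * b == g); case: (b * a == g); case: (a * b^-1 == g);
   case: (b^-1 * a == g); case: (a^-1 * b == g); case: (b * a^-1 == g);
   case: (a^-1 * b^-1 == g); case: (b^-1 * a^-1 == g).
Qed.

Definition sym_mem S u := (u \in S) || (u^-1 \in S).

Lemma cayleyE S x y : cayley S x y = (x != y) && sym_mem S (y * x^-1).
Proof. by rewrite /cayley /sym_mem invMg invgK. Qed.

Lemma not_independentP g S :
  reflect (sym_mem S g \/ exists u v, [/\ sym_mem S u, sym_mem S v & u * v = g])
          (~~ independent (factor_rel g) S).
Proof.
have pmP a u : a \in S -> u \in [:: a; a^-1] -> sym_mem S u.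
  by move=> aS; rewrite !inE /sym_mem => /orP[] /eqP ->; rewrite ?invgK aS ?orbT.
have Pmp u : sym_mem S u -> exists2 a, a \in S & u \in [:: a; a^-1].
  move=> /orP[uS|uS]; first by exists u; rewrite // mem_head.
  by exists u^-1; rewrite // invgK !inE eqxx orbT.
apply: (iffP idP) => [|H].
  rewrite negb_forall_in => /existsP[a /andP[aS]].
  rewrite negb_forall_in => /existsP[b /andP[bS]]; rewrite negbK.
  case/orP => [/hasP[u ua /hasP[v vb /orP[] /eqP uv]]|/andP[_ H]].
  - by right; exists u, v; split=> //; [apply: pmP ua | apply: pmP vb].
  - by right; exists v, u; split=> //; [apply: pmP vb | apply: pmP ua].
  left; apply: (pmP a) => //; rewrite !inE; move: H; by rewrite ![g == _]eq_sym.
rewrite negb_forall_in; case: H => [gS|[u [v [uS vS uv]]]].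
  have [a aS ga] := Pmp _ gS; apply/existsP; exists a; rewrite aS negb_forall_in.
  apply/existsP; exists a; rewrite aS negbK /=; apply/orP; right.
  by move: ga; rewrite eqxx !inE ![g == _]eq_sym.
have [a aS ua] := Pmp _ uS; have [b bS vb] := Pmp _ vS.
apply/existsP; exists a; rewrite aS negb_forall_in.
apply/existsP; exists b; rewrite bS negbK; apply/orP; left.
by apply/hasP; exists u => //; apply/hasP; exists v => //; rewrite uv eqxx.
Qed.

Lemma path_not_independent g S x : g != 1 -> ~~ independent (factor_rel g) S ->
  exists2 s, path (cayley S) x s /\ last x s = g * x & (size s <= 2)%N.
Proof.
move=> g1 /not_independentP[gS|[u [v [uS vS uv]]]].
  exists [:: g * x] => //=; rewrite cayleyE mulgK gS !andbT; split=> //.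
  by apply: contraNneq g1 => /(congr1 (mulg^~ x^-1)); rewrite mulgV mulgK => <-.
(* Nothing prevents [1] from lying in [S]. A trivial factor is dropped, since consecutive vertices
   of a path must differ. *)
have [u1|u1] := eqVneq u 1.
  exists [:: g * x] => //=; rewrite cayleyE mulgK -{2}uv u1 mul1g vS !andbT; split=> //.
  by apply: contraNneq g1 => /(congr1 (mulg^~ x^-1)); rewrite mulgV mulgK => <-.
have [v1|v1] := eqVneq v 1.
  exists [:: g * x] => //=; rewrite cayleyE mulgK -{2}uv v1 mulg1 uS !andbT; split=> //.
  by apply: contraNneq g1 => /(congr1 (mulg^~ x^-1)); rewrite mulgV mulgK => <-.
exists [:: v * x; g * x] => //=; rewrite !cayleyE mulgK vS andbT; split=> //.
have -> : g * x * (v * x)^-1 = u by rewrite -uv invMg !mulgA mulgK mulgK.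
rewrite uS !andbT; apply/andP; split.
  by apply: contraNneq v1 => /(congr1 (mulg^~ x^-1)); rewrite mulgV mulgK => <-.
apply: contraNneq u1 => /mulIg vg; apply/eqP.
by rewrite -[u](mulgK v) uv -vg mulgV.
Qed.

Lemma independent_path_size g S s : g != 1 -> independent (factor_rel g) S ->
  path (cayley S) 1 s -> last 1 s = g -> (2 < size s)%N.
Proof.
move=> g1; rewrite -[independent _ _]negbK => /not_independentP H.
case: s => [_ /esym/eqP|a [|b [|//]]] /=; first by rewrite (negbTE g1).
  rewrite cayleyE invg1 mulg1 andbT => /andP[_ aS] ag.
  by case: H; left; rewrite -ag.
rewrite !cayleyE invg1 mulg1 andbT => /andP[/andP[_ aS] /andP[_ bS]] bg.
by case: H; right; exists (b * a^-1), a; rewrite mulgKV.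
Qed.

End Cayley.

Section CayleyDiameter.
Context (R : realType) (gT : finGroupType).
Implicit Types (S : {set gT}) (g : gT).

Lemma diameter_le2 S :
  (forall g, g != 1%g -> ~~ independent (factor_rel g) S) ->
  (diameter R (cayley S) <= 2%:E)%E.
Proof.
move=> H; apply: ge_ereal_sup => _ [[x y] _ <-] /=.
have [s [sp sl] s2] : exists2 s, path (cayley S) x s /\ last x s = y & (size s <= 2)%N.
  have [<-|xy] := eqVneq x y; first by exists [::].
  have yx : (y * x^-1 != 1)%g by rewrite -eq_mulgV1 eq_sym.
  have := path_not_independent x yx (H _ yx).
  by rewrite mulgKV.
apply: (@le_trans _ _ ((size s)%:R)%:E); last by rewrite lee_fin ler_nat.
by apply: ereal_inf_lbound; exists s.
Qed.

Lemma diameter_gt2 S g : g != 1%g -> independent (factor_rel g) S ->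
  (2%:E < diameter R (cayley S))%E.
Proof.
move=> g1 ind; apply: (@lt_le_trans _ _ 3%:E); first by rewrite lte_fin ltr_nat.
apply: (@le_trans _ _ (gdist R (cayley S) 1%g g)).
  apply: le_ereal_inf_tmp => _ [s [sp sl] <-].
  by rewrite lee_fin ler_nat; apply: independent_path_size ind sp sl.
by apply: ereal_sup_ubound; exists (1%g, g).
Qed.

End CayleyDiameter.

(** * Products with a commutative group *)

Lemma card_nbrs_le (T : finType) (e : rel T) v (s : seq T) :
  (forall b, b != v -> e v b -> b \in s) -> (#|nbrs e v| <= size s)%N.
Proof.
move=> H; apply: leq_trans (card_size s); apply: subset_leq_card.
by apply/subsetP => b; rewrite inE => /andP[/H].
Qed.

Lemma card_nbrs_ge (T : finType) (e : rel T) v (s : seq T) : uniq s ->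
  (forall b, b \in s -> b != v /\ e v b) -> (size s <= #|nbrs e v|)%N.
Proof.
move=> /card_uniqP <- H; apply: subset_leq_card.
by apply/subsetP => b /H[bv evb]; rewrite inE bv.
Qed.

Lemma nbrs_factor_rel_le8 (gT : finGroupType) (g a : gT) :
  (#|nbrs (factor_rel g) a| <= 8)%N.
Proof.
apply: (@card_nbrs_le _ _ _ (factor_seq g a)) => b /negbTE ba.
by rewrite factor_relE eq_sym ba orbF.
Qed.

Section ProductGroup.
Variables (aT cT : finGroupType).
Hypothesis cTC : forall x y : cT, (x * y = y * x)%g.
Hypothesis sqrt_le2 : forall u : cT, (#|[set s | (s * s == u)%g]| <= 2)%N.
Local Open Scope group_scope.
Local Notation gT := (aT * cT)%type.
Implicit Types (s t : cT) (sigma alpha : aT) (g a b : gT).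

(** The coincidences that come from the second coordinate of [a] prescribe its square, so the
    exceptional [a] lie in sets of this form. *)
Definition sqrt_pairs (us : seq cT) : {set gT} := [set a | a.2 * a.2 \in us].

Lemma card_sqrt_pairs us : (#|sqrt_pairs us| <= 2 * size us * #|aT|)%N.
Proof.
elim: us => [|u us IH].
  rewrite muln0 mul0n leqn0 cards_eq0; apply/eqP/setP => a.
  by rewrite !inE.
have -> : sqrt_pairs (u :: us) =
    setX [set: aT] [set s | s * s == u] :|: sqrt_pairs us.
  by apply/setP => a; rewrite !inE.
apply: leq_trans (leq_card_setU _ _) _; rewrite cardsX cardsT /=.
by rewrite mulnS mulnDl leq_add // mulnC leq_mul2r sqrt_le2 orbT.
Qed.

Lemma mulVg_eq (x y z : cT) : (x^-1 * y = z) -> y = x * z.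
Proof. by move=> <-; rewrite mulKVg. Qed.

Definition degree_bound g : nat :=
  ((1 + (g.1 != 1)%g) * (1 + (g.2 * g.2 != 1)%g) * 2)%N.

(** With [g = (sigma, t)] and [s = a.2], the excluded squares have these purposes, in order: [1]
    separates [s] from [s^-1], [t^2] separates [t^-1 s] from [t s^-1], [t^-2] separates [t s] from
    [t^-1 s^-1], and [t], [t^-1] keep [a] itself out of the list. Left and right products by [sigma]
    differ because [sigma] and [a.1] do not commute. *)
Lemma nbrs_factor_rel_ge g a : g != 1 ->
  (g.1 != 1 -> g.1 * a.1 != a.1 * g.1) ->
  a \notin sqrt_pairs [:: 1; g.2 * g.2; (g.2 * g.2)^-1; g.2; g.2^-1] ->
  (degree_bound g <= #|nbrs (factor_rel g) a|)%N.
Proof.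
case: g a => [sigma t] [alpha s] g1 /= com.
rewrite inE /= !inE !negb_or => /and5P[s1 stt sttV st stV].
have fne b : b \in factor_seq (sigma, t) (alpha, s) ->
    b != (alpha, s) /\ factor_rel (sigma, t) (alpha, s) b.
  move=> bf; split; last by rewrite factor_relE bf.
  have ne (x y : gT) : x != y -> forall z, x = z -> z != y by move=> xy z <-.
  have gV1 : (sigma, t)^-1 != 1 :> gT by rewrite invg_eq1.
  move: bf; rewrite !inE; have L (x y : gT) : x != 1 -> x * y != y.
    by move=> x1; rewrite -{2}[y]mul1g (inj_eq (mulIg y)).
  have Rm (x y : gT) : x != 1 -> y * x != y.
    by move=> x1; rewrite -{2}[y]mulg1 (inj_eq (mulgI y)).
  have C1 (x y : aT) (z : cT) : s * s != z -> (x, z * s^-1) != (y, s) :> gT.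
    move=> sz; apply: contra sz; rewrite xpair_eqE => /andP[_ /eqP {1}<-].
    by rewrite mulgKV.
  have C2 (x y : aT) (z : cT) : s * s != z -> (x, s^-1 * z) != (y, s) :> gT.
    by rewrite (cTC s^-1); apply: C1.
  case/orP => [/eqP->|]; first exact: L.
  case/orP => [/eqP->|]; first exact: Rm.
  case/orP => [/eqP->|]; first exact: L.
  case/orP => [/eqP->|]; first exact: Rm.
  case/orP => [/eqP->|]; first exact: C1.
  case/orP => [/eqP->|]; first exact: C2.
  by case/orP => /eqP ->; [apply: C1 | apply: C2].
have h1 : t * s != t * s^-1.
  by apply: contra s1 => /eqP/mulgI {2}->; rewrite mulgV.
have h2 : t^-1 * s != t^-1 * s^-1.
  by apply: contra s1 => /eqP/mulgI {2}->; rewrite mulgV.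
have h3 : t * s != t^-1 * s^-1.
  apply: contra sttV => /eqP E; rewrite -{1}(mulKg t s) E.
  by rewrite invMg -!mulgA mulVg mulg1.
have h4 : t^-1 * s != t * s^-1.
  by apply: contra stt => /eqP/mulVg_eq {1}->; rewrite -!mulgA mulVg mulg1.
have h5 : t * t != 1 -> t * s != t^-1 * s.
  by apply: contra => /eqP/mulIg {2}->; rewrite mulgV.
have h6 : t * t != 1 -> t * s^-1 != t^-1 * s^-1.
  by apply: contra => /eqP/mulIg {2}->; rewrite mulgV.
have c1 : sigma != 1 -> sigma * alpha != alpha * sigma by [].
have comV (x y : aT) : x^-1 * y = y * x^-1 -> x * y = y * x.
  by move=> /commute_sym/commuteV/commute_sym; rewrite invgK.
have comV2 (x y : aT) : x * y^-1 = y^-1 * x -> x * y = y * x.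
  by move=> /commuteV; rewrite invgK.
have c2 : sigma != 1 -> sigma^-1 * alpha != alpha * sigma^-1.
  by move=> /c1; apply: contraNneq => /comV ->.
have c3 : sigma != 1 -> sigma * alpha^-1 != alpha^-1 * sigma.
  by move=> /c1; apply: contraNneq => /comV2 ->.
have c4 : sigma != 1 -> sigma^-1 * alpha^-1 != alpha^-1 * sigma^-1.
  by move=> /c1; apply: contraNneq => /comV2/comV ->.
rewrite /degree_bound /=.
have sub (l : seq gT) : uniq l -> {subset l <= factor_seq (sigma, t) (alpha, s)} ->
    (size l <= #|nbrs (factor_rel (sigma, t)) (alpha, s)|)%N.
  by move=> ul lf; apply: card_nbrs_ge => // b /lf/fne.
have fE : factor_seq (sigma, t) (alpha, s) =
  [:: (sigma * alpha, t * s); (alpha * sigma, t * s);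
      (sigma^-1 * alpha, t^-1 * s); (alpha * sigma^-1, t^-1 * s);
      (sigma * alpha^-1, t * s^-1); (alpha^-1 * sigma, t * s^-1);
      (sigma^-1 * alpha^-1, t^-1 * s^-1); (alpha^-1 * sigma^-1, t^-1 * s^-1)].
  transitivity [:: (sigma * alpha, t * s); (alpha * sigma, s * t);
      (sigma^-1 * alpha, t^-1 * s); (alpha * sigma^-1, s * t^-1);
      (sigma * alpha^-1, t * s^-1); (alpha^-1 * sigma, s^-1 * t);
      (sigma^-1 * alpha^-1, t^-1 * s^-1); (alpha^-1 * sigma^-1, s^-1 * t^-1)].
    by [].
  by rewrite (cTC s t) (cTC s t^-1) (cTC s^-1 t) (cTC s^-1 t^-1).
have eqF (T : eqType) (x y : T) : x != y -> ((x == y) = false) * ((y == x) = false).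
  by move=> xy; rewrite [y == x]eq_sym (negbTE xy).
(* When [sigma = 1] left and right products coincide, and when [t^2 = 1] the second coordinates no
   longer tell [t] from [t^-1]; each case keeps only candidates that are still known to be
   distinct. *)
have [sigma1|sigma1] /= := boolP (sigma != 1); have [tt1|tt1] /= := boolP (t * t != 1).
- apply: (sub (factor_seq (sigma, t) (alpha, s))) => //.
  rewrite fE /= !inE !xpair_eqE.
  by rewrite !(eqF _ _ _ h1, eqF _ _ _ h2, eqF _ _ _ h3, eqF _ _ _ h4,
    eqF _ _ _ (h5 tt1), eqF _ _ _ (h6 tt1), eqF _ _ _ (c1 sigma1), eqF _ _ _ (c2 sigma1),
    eqF _ _ _ (c3 sigma1), eqF _ _ _ (c4 sigma1), andbF).
- apply: (sub [:: (sigma * alpha, t * s); (alpha * sigma, t * s);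
      (sigma * alpha^-1, t * s^-1); (alpha^-1 * sigma, t * s^-1)]).
    rewrite /= !inE !xpair_eqE.
    by rewrite !(eqF _ _ _ h1, eqF _ _ _ (c1 sigma1), eqF _ _ _ (c3 sigma1), andbF).
  by move=> x; rewrite fE !inE => /or4P[] ->; rewrite ?orbT.
- apply: (sub [:: (sigma * alpha, t * s); (sigma^-1 * alpha, t^-1 * s);
      (sigma * alpha^-1, t * s^-1); (sigma^-1 * alpha^-1, t^-1 * s^-1)]).
    rewrite /= !inE !xpair_eqE.
    by rewrite !(eqF _ _ _ h1, eqF _ _ _ h2, eqF _ _ _ h3, eqF _ _ _ h4,
      eqF _ _ _ (h5 tt1), eqF _ _ _ (h6 tt1), andbF).
  by move=> x; rewrite fE !inE => /or4P[] ->; rewrite ?orbT.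
apply: (sub [:: (sigma * alpha, t * s); (sigma * alpha^-1, t * s^-1)]).
  by rewrite /= !inE !xpair_eqE (eqF _ _ _ h1) andbF.
by move=> x; rewrite fE !inE => /orP[] ->; rewrite ?orbT.
Qed.

End ProductGroup.

(** * From independence probabilities to the diameter *)

Section CayleyProbability.
Context (R : realType) (gT : finGroupType).
Implicit Types (p q : R).

Lemma random_subset_probE p (E : pred {set gT}) :
  random_subset_prob p E = subset_mean p [set: gT] (fun S => (E S)%:R).
Proof.
rewrite -subset_mean_setT /random_subset_prob [LHS]big_mkcond /=.
by apply: eq_bigr => S _; case: (E S); rewrite ?mulr1 ?mulr0.
Qed.

Lemma random_subset_prob_le1 p (E : pred {set gT}) : 0 <= p <= 1 ->
  random_subset_prob p E <= 1.
Proof.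
move=> p01; rewrite random_subset_probE -[leRHS](subset_mean_cst p [set: gT]).
by apply: ler_subset_mean => // S _; rewrite lern1 leq_b1.
Qed.

(** A union bound over [g != 1]. It may be evaluated at the smaller [q], because independence passes
    to subsets and so becomes less likely as [q] grows to [p]. *)
Lemma prob_diameter_le2_ge q p : 0 <= q -> q <= p -> p <= 1 ->
  1 - \sum_(g : gT | g != 1%g) indep_prob q (factor_rel g) [set: gT] <=
  random_subset_prob p (fun S : {set gT} => diameter R (cayley S) <= 2%:E)%E.
Proof.
move=> q0 qp p1; have p01 : 0 <= p <= 1 by lra.
rewrite random_subset_probE lerBlDr.
have H : \sum_(g : gT | g != 1%g) indep_prob p (factor_rel g) [set: gT] <=
         \sum_(g : gT | g != 1%g) indep_prob q (factor_rel g) [set: gT].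
  apply: ler_sum => g _; apply: subset_mean_antitone => //.
  by move=> S S'; apply: independent_antitone.
apply: le_trans (lerD (lexx _) H); rewrite -subset_mean_sum -subset_meanD.
rewrite -[leLHS](subset_mean_cst p [set: gT]); apply: ler_subset_mean => // S _.
have sum0 : 0 <= \sum_(g : gT | g != 1%g) (independent (factor_rel g) S)%:R :> R.
  exact: sumr_ge0.
have [g /andP[g1 gS]|none] := pickP (fun g => (g != 1%g) && independent (factor_rel g) S).
  rewrite (bigD1 g) //= gS addrCA lerDl addr_ge0 ?ler0n //.
  exact: sumr_ge0.
rewrite diameter_le2 ?lerDl // => g g1.
by have := none g; rewrite g1 /= => ->.
Qed.

Lemma prob_diameter_gt2_ge (I : finType) (J : {set I}) (f : I -> gT) p :
  0 <= p <= 1 -> {in J, forall i, f i != 1%g} ->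
  1 - subset_mean p [set: gT]
        (fun S => [forall i in J, ~~ independent (factor_rel (f i)) S]%:R) <=
  random_subset_prob p (fun S : {set gT} => 2%:E < diameter R (cayley S))%E.
Proof.
move=> p01 f1; rewrite random_subset_probE lerBlDr -subset_meanD.
rewrite -[leLHS](subset_mean_cst p [set: gT]); apply: ler_subset_mean => // S _.
case: (boolP [forall i in J, _]) => [_|]; first by rewrite lerDr.
rewrite negb_forall_in => /existsP[i /andP[iJ]]; rewrite negbK => iS.
by rewrite (diameter_gt2 R (f1 i iJ) iS) addr0.
Qed.

End CayleyProbability.

Lemma sum_bool_natr (R : realType) (T : finType) (P : pred T) :
  \sum_(x : T) (P x)%:R = #|[set x | P x]|%:R :> R.
Proof.
rewrite -sum1_card natr_sum [RHS]big_mkcond; apply: eq_bigr => x _.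
by rewrite inE; case: (P x).
Qed.

(** * Edge counts and the union bound in a product group *)

Section ProductGroupBounds.
Variables (R : realType) (aT cT : finGroupType).
Hypothesis cTC : forall x y : cT, (x * y = y * x)%g.
Hypothesis sqrt_le2 : forall u : cT, (#|[set s | (s * s == u)%g]| <= 2)%N.
Local Notation gT := (aT * cT)%type.
Implicit Types (s t : cT) (g a b : gT) (q : R).
Local Notation nA := (#|aT|%:R : R).
Local Notation nC := (#|cT|%:R : R).
Local Notation nG := (#|{: gT}|%:R : R).

(** Two exceptional sets are discarded: the elements whose first coordinate commutes with a
    nontrivial [g.1], a proportion at most [1/r], and those whose second coordinate has one of five
    squares, a proportion at most [10 / nC] since each square has at most two roots. *)
Lemma arcs_factor_rel_ge g r : g != 1%g -> (0 < r)%N ->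
  (forall sigma : aT, sigma != 1%g ->
    (r * #|[set alpha | (sigma * alpha == alpha * sigma)%g]| <= #|aT|)%N) ->
  (degree_bound g)%:R * (nG * (1 - (r%:R^-1 + 10 / nC))) <=
  (arcs (factor_rel g) [set: gT])%:R.
Proof.
move=> g1 r0 cent.
pose C : {set gT} := if g.1 == 1%g then set0 else
  setX [set alpha | (g.1 * alpha == alpha * g.1)%g] [set: cT].
pose B := sqrt_pairs aT [:: 1; g.2 * g.2; (g.2 * g.2)^-1; g.2; g.2^-1]%g.
have cC : (r * #|C| <= #|{: gT}|)%N.
  rewrite /C card_prod; case: eqVneq => [_|s1]; first by rewrite cards0 muln0.
  by rewrite cardsX cardsT mulnA leq_mul2r cent ?orbT.
have cB : (#|B| <= 10 * #|aT|)%N by exact: card_sqrt_pairs.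
have H : (degree_bound g * #|~: (C :|: B)| <= arcs (factor_rel g) [set: gT])%N.
  rewrite /arcs mulnC -sum_nat_const.
  rewrite [leqRHS](bigID (mem (C :|: B))) /= addnC; apply: leq_trans (leq_addr _ _).
  rewrite big_mkcond [leqRHS]big_mkcond /=; apply: leq_sum => a _.
  rewrite setIT in_setC; case: ifP => //; rewrite in_setU negb_or in_setT.
  move=> /andP[aC aB] /=.
  apply: (nbrs_factor_rel_ge cTC) => // s1; move: aC; rewrite /C (negbTE s1).
  by rewrite !inE andbT.
apply: le_trans (_ : (degree_bound g * #|~: (C :|: B)|)%:R <= _); last by rewrite ler_nat.
rewrite natrM; apply: ler_wpM2l => //.
have C0 : (0 < #|cT|)%N by apply/card_gt0P; exists 1%g.
have nC0 : 0 < nC by rewrite ltr0n.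
have nr0 : 0 < r%:R :> R by rewrite ltr0n.
have cC' : #|C|%:R <= nG / r%:R.
  by rewrite ler_pdivlMr // -natrM ler_nat mulnC.
have cB' : #|B|%:R <= 10 * nA by rewrite -natrM ler_nat.
have -> : nG * (1 - (r%:R^-1 + 10 / nC)) = nG - nG / r%:R - 10 * nA.
  by rewrite card_prod natrM; field; rewrite !gt_eqF.
have : (#|{: gT}| <= #|~: (C :|: B)| + (#|C| + #|B|))%N.
  by rewrite -(cardsC (C :|: B)) addnC leq_add2l leq_card_setU.
rewrite -(ler_nat R) !natrD; lra.
Qed.

Lemma indep_prob_factor_rel_le g q r : g != 1%g -> (0 < r)%N ->
  (forall sigma : aT, sigma != 1%g ->
    (r * #|[set alpha | (sigma * alpha == alpha * sigma)%g]| <= #|aT|)%N) ->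
  0 <= q -> 16 * q <= 1 ->
  indep_prob q (factor_rel g) [set: gT] <=
  expR (- ((1 + (g.1 != 1%g)) * (1 + (g.2 * g.2 != 1)%g))%:R *
          (q ^+ 2 * (1 - 16 * q) * (nG * (1 - (r%:R^-1 + 10 / nC))))).
Proof.
move=> g1 r0 cent q0 q16.
(* The exponential upper bound requires a loopless relation; erasing loops can only make
   independence more likely. The factor 2 in [degree_bound] then cancels the half in the
   exponent. *)
pose e : rel gT := fun a b => (a != b) && factor_rel g a b.
have esym : symmetric e by move=> a b; rewrite /e eq_sym factor_rel_sym.
have nE a : nbrs e a = nbrs (factor_rel g) a.
  by apply/setP => b; rewrite !inE /e eq_sym; case: eqVneq.
have deg a : (#|nbrs e a| <= 8)%N by rewrite nE nbrs_factor_rel_le8.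
have q01 : 0 <= q <= 1 by lra.
apply: (@le_trans _ _ (indep_prob q e [set: gT])).
  apply: ler_subset_mean => // S _; rewrite ler_nat.
  case: (boolP (independent (factor_rel g) S)) => // /independentP H.
  suff -> : independent e S by [].
  by apply/independentP => a b aS bS; rewrite /e negb_and H ?orbT.
apply: le_trans (indep_prob_le_expR q0 _ _ esym deg _) _; try by rewrite -?natrM; lra.
  by move=> a _; rewrite /e eqxx.
rewrite ler_expR -natrM mulNr lerN2.
have := arcs_factor_rel_ge g1 r0 cent.
have -> : arcs (factor_rel g) [set: gT] = arcs e [set: gT].
  by apply: eq_bigr => a _; rewrite nE.
rewrite /degree_bound natrM; set D := (_ * _)%:R; set M := nG * _.
set Ar := (arcs _ _)%:R => H.
have w0 : 0 <= q ^+ 2 * (1 - 16 * q) by rewrite mulr_ge0 ?sqr_ge0 //; lra.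
have := ler_wpM2l w0 H; lra.
Qed.

Lemma sum_indep_prob_factor_rel_le q r : (0 < r)%N ->
  (forall sigma : aT, sigma != 1%g ->
    (r * #|[set alpha | (sigma * alpha == alpha * sigma)%g]| <= #|aT|)%N) ->
  0 <= q -> 16 * q <= 1 ->
  forall y, y = q ^+ 2 * (1 - 16 * q) * (nG * (1 - (r%:R^-1 + 10 / nC))) ->
  \sum_(g : gT | g != 1%g) indep_prob q (factor_rel g) [set: gT] <=
  2 * expR (- y) + (nC + 2 * nA) * expR (- (2 * y)) + nG * expR (- (4 * y)).
Proof.
move=> r0 cent q0 q16 y yE.
(* Instead of partitioning the [g] into four classes, [F] adds the term of every class whose
   conditions hold; the sums of the indicators are then cardinals of products. *)
pose F g : R := (g.1 == 1%g)%:R * (g.2 * g.2 == 1)%g%:R * expR (- y) +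
  ((g.1 == 1%g)%:R * expR (- (2 * y)) + (g.2 * g.2 == 1)%g%:R * expR (- (2 * y)) +
   expR (- (4 * y))).
have F0 g : 0 <= F g by rewrite /F !addr_ge0 ?mulr_ge0 ?expR_ge0.
apply: (@le_trans _ _ (\sum_(g : gT) F g)).
  rewrite [leLHS]big_mkcond /=; apply: ler_sum => g _; case: ifP => // g1.
  apply: le_trans (indep_prob_factor_rel_le g1 r0 cent q0 q16) _; rewrite -yE /F.
  have E1 := expR_ge0 (- y); have E2 := expR_ge0 (- (2 * y)).
  have E4 := expR_ge0 (- (4 * y)).
  case: (g.1 == 1%g); case: (g.2 * g.2 == 1)%g => /=;
    rewrite ?addn0 ?muln1 ?mul1n ?mulr1 ?mul1r ?mul0r ?add0r ?addr0 ?mulN1r ?mulNr //.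
  - lra.
  - lra.
  - lra.
have S1 : \sum_(g : gT) ((g.1 == 1%g)%:R : R) = nC.
  rewrite sum_bool_natr; congr (_%:R).
  rewrite (eq_card (B := setX [set 1%g] [set: cT])); last by move=> x; rewrite !inE andbT.
  by rewrite cardsX cards1 mul1n cardsT.
have S2 : \sum_(g : gT) ((g.2 * g.2 == 1)%g%:R : R) <= 2 * nA.
  rewrite sum_bool_natr -natrM ler_nat.
  rewrite (eq_card (B := setX [set: aT] [set s : cT | (s * s == 1)%g]));
    last by move=> x; rewrite !inE.
  by rewrite cardsX cardsT mulnC leq_mul2r sqrt_le2 orbT.
have S12 : \sum_(g : gT) ((g.1 == 1%g)%:R * (g.2 * g.2 == 1)%g%:R : R) <= 2.
  under eq_bigr do rewrite -natrM mulnb.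
  rewrite sum_bool_natr ler_nat.
  rewrite (eq_card (B := setX [set 1%g] [set s : cT | (s * s == 1)%g]));
    last by move=> x; rewrite !inE.
  by rewrite cardsX cards1 mul1n sqrt_le2.
rewrite /F !big_split /= -!mulr_suml S1 sumr_const -mulr_natl.
have E1 := expR_ge0 (- y); have E2 := expR_ge0 (- (2 * y)).
have := ler_wpM2r E1 S12; have := ler_wpM2r E2 S2.
rewrite !mulrDl; lra.
Qed.

End ProductGroupBounds.

(** * Central elements *)

Section CentralElements.
Variables (R : realType) (aT cT : finGroupType).
Hypothesis cTC : forall x y : cT, (x * y = y * x)%g.
Hypothesis sqrt_le2 : forall u : cT, (#|[set s | (s * s == u)%g]| <= 2)%N.
Local Notation gT := (aT * cT)%type.
Implicit Types (s t : cT) (a b : gT) (q : R).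
Local Notation nA := (#|aT|%:R : R).
Local Notation nG := (#|{: gT}|%:R : R).
Local Notation central t := ((1%g : aT), t).

(** For central [g] left and right products agree, so the eight candidates of [factor_seq] collapse
    to these four. *)
Definition central_seq t a : seq gT :=
  [:: (a.1, t * a.2); (a.1, t^-1 * a.2);
      (a.1^-1, t * a.2^-1); (a.1^-1, t^-1 * a.2^-1)]%g.

Lemma factor_seq_central t a : factor_seq (central t) a =i central_seq t a.
Proof.
case: a => alpha s b; rewrite /central_seq /=.
have -> : factor_seq (central t) (alpha, s) = [:: (1 * alpha, t * s); (alpha * 1, s * t);
  (1^-1 * alpha, t^-1 * s); (alpha * 1^-1, s * t^-1);
  (1 * alpha^-1, t * s^-1); (alpha^-1 * 1, s^-1 * t);
  (1^-1 * alpha^-1, t^-1 * s^-1); (alpha^-1 * 1^-1, s^-1 * t^-1)]%g by [].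
rewrite invg1 !mul1g !mulg1 (cTC s t) (cTC s t^-1) (cTC s^-1 t) (cTC s^-1 t^-1).
by rewrite !inE; do 4!case: (b == _).
Qed.

Lemma factor_rel_central t a b : factor_rel (central t) a b =
  (b \in central_seq t a) || (a == b) && ((a == central t) || (a^-1%g == central t)).
Proof. by rewrite factor_relE factor_seq_central. Qed.

Lemma nbrs_centralP t a b :
  b \in nbrs (factor_rel (central t)) a -> b \in central_seq t a.
Proof. by rewrite inE eq_sym factor_rel_central => /andP[/negbTE ->]; rewrite orbF. Qed.

Lemma card_nbrs_central t a : (#|nbrs (factor_rel (central t)) a| <= 4)%N.
Proof.
apply: leq_trans (card_size (central_seq t a)); apply: subset_leq_card.
by apply/subsetP => b; apply: nbrs_centralP.
Qed.

Lemma arcs_central_le t : (arcs (factor_rel (central t)) [set: gT] <= 4 * #|{: gT}|)%N.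
Proof.
rewrite /arcs mulnC -cardsT -sum_nat_const; apply: leq_sum => a _.
by rewrite setIT card_nbrs_central.
Qed.

Lemma loop_central t a : t != 1%g -> factor_rel (central t) a a ->
  (a \in [:: central t; central t^-1%g]) || (a \in sqrt_pairs aT [:: t; t^-1%g]).
Proof.
move=> t1; rewrite factor_rel_central eqxx /= [in X in _ -> X]inE => /orP[|]; last first.
  move=> H; apply/orP; left; rewrite !inE; case/orP: H => [->//|/eqP H].
  by rewrite -[a]invgK H /= -[((1, t)^-1)%g]/((1^-1, t^-1)%g) invg1 eqxx orbT.
case: a => alpha s /=; rewrite !inE !xpair_eqE => /or4P[] /andP[_ /eqP H].
- by case/eqP: t1; apply: (mulIg s); rewrite mul1g.
- by case/eqP: t1; apply: invg_inj; apply: (mulIg s); rewrite invg1 mul1g.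
- by apply/orP; right; rewrite {1}H mulgKV eqxx.
- by apply/orP; right; rewrite {1 3}H !mulgKV eqxx orbT.
Qed.

Lemma card_loops_central t : t != 1%g ->
  (#|[set a | factor_rel (central t) a a]| <= 4 * #|aT| + 2)%N.
Proof.
move=> t1; set s := [:: central t; central t^-1%g].
apply: (@leq_trans (#|sqrt_pairs aT [:: t; t^-1%g]| + #|[set a in s]|)).
  apply: leq_trans (leq_card_setU _ _); apply: subset_leq_card.
  apply/subsetP => a; rewrite [in X in X -> _]inE in_setU => /(loop_central t1).
  have -> : (a \in [set x in s]) = (a \in s) by rewrite inE.
  by rewrite -/s orbC.
rewrite leq_add //; first exact: card_sqrt_pairs.
by rewrite cardsE (leq_trans (card_size s)).
Qed.

Section Pair.
Variables (t t' : cT).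
Hypotheses (t1 : t != 1%g) (t'1 : t' != 1%g) (tt' : t != t') (ttV : (t * t' != 1)%g).

(** Comparing second coordinates, a common neighbour equates some [t^+-1 s^+-1] with some
    [t'^+-1 s^+-1]. Equal signs of [s] would give [t' = t^+-1], and opposite signs prescribe
    [s^2]. *)
Lemma overlap_central a :
  nbrs (factor_rel (central t)) a :&: nbrs (factor_rel (central t')) a != set0 ->
  a \in sqrt_pairs aT [:: t^-1 * t'; t^-1 * t'^-1; t * t'; t * t'^-1]%g.
Proof.
have ttV2 : t != t'^-1%g.
  by apply: contra ttV => /eqP ->; rewrite mulVg.
have ttV3 : t^-1%g != t' by apply: contra ttV => /eqP <-; rewrite mulgV.
have ttV4 : t^-1%g != t'^-1%g by rewrite (inj_eq invg_inj).
case/set0Pn => b /setIP[/nbrs_centralP b1 /nbrs_centralP b2].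
have {b1 b2} [b1 b2] : b.2 \in map snd (central_seq t a) /\
    b.2 \in map snd (central_seq t' a) by split; apply: map_f.
rewrite inE; move: b1 b2; rewrite /=; move: b.2 a.2 => w s.
have Q (x y : cT) : (x * s = y * s^-1 -> s * s = x^-1 * y)%g.
  by move=> /(congr1 (mulg x^-1)); rewrite mulKg => {1}->; rewrite -!mulgA mulVg mulg1.
have Ql (x y : cT) : (x * s^-1 = y * s -> s * s = x * y^-1)%g.
  by move=> /esym/Q ->; rewrite cTC.
rewrite !inE => /or4P[] /eqP -> /or4P[] /eqP H.
- by move: tt'; rewrite (mulIg _ _ _ H) eqxx.
- by move: ttV2; rewrite (mulIg _ _ _ H) eqxx.
- by rewrite (Q _ _ H) eqxx ?orbT.
- by rewrite (Q _ _ H) eqxx ?orbT.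
- by move: ttV3; rewrite (mulIg _ _ _ H) eqxx.
- by move: ttV4; rewrite (mulIg _ _ _ H) eqxx.
- by rewrite (Q _ _ H) invgK eqxx ?orbT.
- by rewrite (Q _ _ H) invgK eqxx ?orbT.
- by rewrite (Ql _ _ H) eqxx ?orbT.
- by rewrite (Ql _ _ H) invgK eqxx ?orbT.
- by move: tt'; rewrite (mulIg _ _ _ H) eqxx.
- by move: ttV2; rewrite (mulIg _ _ _ H) eqxx.
- by rewrite (Ql _ _ H) eqxx ?orbT.
- by rewrite (Ql _ _ H) invgK eqxx ?orbT.
- by move: ttV3; rewrite (mulIg _ _ _ H) eqxx.
- by move: ttV4; rewrite (mulIg _ _ _ H) eqxx.
Qed.

(** A loop at [a] for [t] means that [a] is the central element or its inverse, or that the square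
    of [a.2] is [t^+-1]. The last alternative cannot hold for both [t] and [t'], which leaves four
    elements. *)
Lemma card_double_loops :
  (#|[set a | factor_rel (central t) a a && factor_rel (central t') a a]| <= 4)%N.
Proof.
set s := [:: central t; central t^-1%g; central t'; central t'^-1%g].
apply: leq_trans (card_size s); apply: subset_leq_card; apply/subsetP => a.
rewrite [in X in X -> _]inE => /andP[/(loop_central t1) H /(loop_central t'1) H'].
rewrite -[s]/([:: central t; central t^-1%g] ++ [:: central t'; central t'^-1%g]).
rewrite mem_cat; case/orP: H => [-> //|]; case/orP: H' => [->|]; first by rewrite orbT.
rewrite !inE => /orP[/eqP ->|/eqP ->] /orP[/eqP H|/eqP H].
- by move: tt'; rewrite H eqxx.
- by move: ttV; rewrite H mulgV eqxx.
- by move: ttV; rewrite -H mulVg eqxx.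
- by move: tt'; rewrite (invg_inj H) eqxx.
Qed.

(** Two graphs of degree at most 4 give [d = 8], whence [256 = 4 d^2] and [32 = 4 d]. There are at
    most [8 nA] overlaps, [8 nA + 4] loops and 4 double loops. *)
Lemma joint_indep_prob_central q : 0 <= q -> 16 * q <= 1 ->
  indep_prob q (fun a b => factor_rel (central t) a b || factor_rel (central t') a b)
    [set: gT] <=
  expR (256 * q ^+ 3 * nG + 32 * q ^+ 2 * (16 * nA + 4) + 8 * q) *
  (indep_prob q (factor_rel (central t)) [set: gT] *
   indep_prob q (factor_rel (central t')) [set: gT]).
Proof.
move=> q0 q16.
have deg a : (#|nbrs (fun a b => factor_rel (central t) a b ||
    factor_rel (central t') a b) a| <= 8)%N.
  have -> : nbrs (fun a b => factor_rel (central t) a b ||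
    factor_rel (central t') a b) a =
    nbrs (factor_rel (central t)) a :|: nbrs (factor_rel (central t')) a.
    by apply/setP => x; rewrite !inE -andb_orr.
  by apply: leq_trans (leq_card_setU _ _) _; rewrite (@leq_add _ _ 4 4) ?card_nbrs_central.
have q2 : q <= 1 / 2 by lra.
have dq : 2 * 8 * q <= 1 by lra.
apply: le_trans (joint_indep_prob_le (@factor_rel_sym _ _)
  (@factor_rel_sym _ _) deg q0 q2 dq) _.
apply: ler_wpM2r; first by rewrite mulr_ge0 // indep_prob_ge0 //; lra.
set nX := #|[set _ | _ != set0]|; set nL := #|[set _ | _ || _]|.
set nD := #|[set _ | _ && _]|.
have hX : (nX <= 8 * #|aT|)%N.
  have := card_sqrt_pairs aT sqrt_le2 [:: t^-1 * t'; t^-1 * t'^-1; t * t'; t * t'^-1]%g.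
  apply: leq_trans.
  apply: subset_leq_card; apply/subsetP => a; rewrite [in X in X -> _]inE.
  exact: overlap_central.
have hL : (nL <= 8 * #|aT| + 4)%N.
  apply: (@leq_trans ((4 * #|aT| + 2) + (4 * #|aT| + 2))%N); last lia.
  apply: leq_trans (leq_add (card_loops_central t1) (card_loops_central t'1)).
  apply: leq_trans (leq_card_setU _ _); apply: subset_leq_card.
  by apply/subsetP => a; rewrite !inE.
have hD : (nD <= 4)%N by exact: card_double_loops.
have hXL : ((nX + nL)%:R : R) <= 16 * nA + 4.
  by rewrite -natrM -natrD ler_nat; lia.
have hD' : (nD%:R : R) <= 4 by rewrite ler_nat.
have qq : 0 <= q ^+ 2 by rewrite sqr_ge0.
rewrite ler_expR; have := ler_wpM2l qq hXL; have := ler_wpM2l q0 hD'.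
rewrite expr2; lra.
Qed.

End Pair.

Lemma indep_prob_central_ge t q : t != 1%g -> 0 <= q -> 16 * q <= 1 ->
  expR (- (q / (1 - q) * (4 * nA + 2) + 2 * (q ^+ 2 / (1 - 8 * q ^+ 2)) * nG)) <=
  indep_prob q (factor_rel (central t)) [set: gT].
Proof.
move=> t1 q0 q16; have q01 : 0 <= q < 1 by lra.
have qq : 0 <= q ^+ 2 by rewrite sqr_ge0.
have dq : 8 * q ^+ 2 < 1 by rewrite expr2; nra.
have deg a : (#|nbrs (factor_rel (central t)) a| <= 8)%N by exact: nbrs_factor_rel_le8.
apply: le_trans (indep_prob_ge_expR _ q01 dq (@factor_rel_sym _ _) deg).
rewrite ler_expR lerN2; apply: lerD.
  apply: ler_wpM2l; first by rewrite divr_ge0 //; lra.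
  rewrite -natrM -natrD ler_nat; apply: leq_trans (card_loops_central t1).
  by apply: subset_leq_card; apply/subsetP => a; rewrite !inE.
set w := q ^+ 2 / _.
have w0 : 0 <= w by rewrite /w divr_ge0 //; lra.
have : (arcs (factor_rel (central t)) [set: gT])%:R <= 4 * nG.
  by rewrite -natrM ler_nat arcs_central_le.
move=> /(ler_wpM2l w0); lra.
Qed.

(** The second moment method for the central elements with [t] in [J]; [lo] bounds their expected
    number from below. [J] contains no two distinct mutually inverse elements, because [t] and
    [t^-1] define the same graph. *)
Lemma prob_diameter_gt2_central_ge (J : {set cT}) q (lo : R) : 0 <= q -> 16 * q <= 1 ->
  {in J, forall t, t != 1%g} ->
  {in J &, forall t t', t != t' -> (t * t' != 1)%g} ->
  0 < lo ->
  lo <= #|J|%:R * expR (- (q / (1 - q) * (4 * nA + 2) +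
                           2 * (q ^+ 2 / (1 - 8 * q ^+ 2)) * nG)) ->
  1 - (lo^-1 + (expR (256 * q ^+ 3 * nG + 32 * q ^+ 2 * (16 * nA + 4) + 8 * q) - 1)) <=
  random_subset_prob q (fun S : {set gT} => 2%:E < diameter R (cayley S))%E.
Proof.
move=> q0 q16 J1 JV lo0 loJ; have q01 : 0 <= q <= 1 by lra.
have f1 : {in J, forall t, central t != 1%g :> gT}.
  by move=> t /J1; apply: contraNneq => /(congr1 snd) tE; apply/eqP; exact: tE.
apply: le_trans (prob_diameter_gt2_ge q01 f1).
rewrite lerD2l lerN2; set D := expR _.
have D1 : 1 <= D.
  rewrite -[leLHS]expR0 ler_expR !addr_ge0 ?mulr_ge0 ?exprn_ge0 //.
have mu_ge : lo <= \sum_(t in J) indep_prob q (factor_rel (central t)) [set: gT].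
  apply: le_trans loJ _; rewrite mulr_natl -sumr_const; apply: ler_sum => t tJ.
  by apply: indep_prob_central_ge => //; apply: J1.
have mu0 : 0 < \sum_(t in J) indep_prob q (factor_rel (central t)) [set: gT].
  exact: lt_le_trans mu_ge.
apply: le_trans (second_moment_subset_mean (delta := D - 1) q01 _ mu0 _) _; first lra.
  move=> t t' tJ t'J tt'.
  rewrite addrC subrK.
  have := joint_indep_prob_central (J1 _ tJ) (J1 _ t'J) tt' (JV _ _ tJ t'J tt') q0 q16.
  apply: le_trans; apply: ler_subset_mean => // S _; rewrite ler_nat.
  case: andP => // -[/independentP H /independentP H'].
  suff -> : independent (fun a b => factor_rel (central t) a b ||
    factor_rel (central t') a b) S by [].
  by apply/independentP => a b aS bS; rewrite negb_or H // H'.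
by rewrite lerD2r lef_pV2.
Qed.

End CentralElements.

(** * Symmetric and cyclic groups *)

(** If [sigma] moves [i], conjugating it by the transposition of [sigma i] and [k] gives a
    permutation sending [i] to [k], for every [k != i]. These [n - 1] conjugates are distinct. *)
Lemma card_class_perm_ge n (sigma : 'S_n) : sigma != 1%g ->
  (n.-1 <= #|(sigma ^: [set: 'S_n])%g|)%N.
Proof.
move=> sigma1.
have [i si] : exists i, sigma i != i.
  apply/existsP; rewrite -negb_forall; apply: contra sigma1 => /forallP H.
  by apply/eqP/permP => i; rewrite perm1; apply/eqP.
pose f k := (sigma ^ tperm (sigma i) k)%g.
have fi k : k != i -> f k i = k.
  move=> ki; rewrite /f; have := permJ sigma (tperm (sigma i) k) i.
  by rewrite (tpermD si ki) tpermL.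
have finj : {in [set~ i] &, injective f}.
  by move=> j k; rewrite !inE => ji ki fE; rewrite -(fi j ji) -(fi k ki) fE.
have -> : n.-1 = #|[set~ i]| by rewrite cardsC1 card_ord.
rewrite -(card_in_imset finj); apply: subset_leq_card; apply/subsetP => _ /imsetP[k _ ->].
by apply: memJ_class; rewrite inE.
Qed.

Lemma card_cent_perm_le n (sigma : 'S_n) : sigma != 1%g ->
  (n.-1 * #|[set alpha : 'S_n | (sigma * alpha == alpha * sigma)%g]| <= #|{: 'S_n}|)%N.
Proof.
move=> /card_class_perm_ge H.
have <- : #|'C_[set: 'S_n][sigma]%g| =
    #|[set alpha : 'S_n | (sigma * alpha == alpha * sigma)%g]|.
  apply: eq_card => alpha; rewrite in_setI in_setT [RHS]inE.
  by apply/cent1P/eqP => [->|E]; rewrite // /commute E.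
rewrite -cardsT -(Lagrange (subcent1_sub sigma [set: 'S_n]%G)) index_cent1 mulnC.
by rewrite leq_mul2l H orbT.
Qed.

(** As an integer [2 s] is less than [2 (m + 1)], so it can only be [u] or [u + m + 1]. *)
Lemma card_sqrt_Zp_le2 m (u : 'I_m.+1) : (#|[set s : 'I_m.+1 | (s * s == u)%g]| <= 2)%N.
Proof.
pose l := [:: inord u./2; inord (u + m.+1)./2 : 'I_m.+1].
apply: leq_trans (card_size l); apply: subset_leq_card; apply/subsetP => s.
rewrite !inE => /eqP E; have {E} : ((s + s) %% m.+1 = u)%N by rewrite -E.
have sm := ltn_ord s; rewrite addnn => E.
have [sl|sl] := ltnP s.*2 m.+1.
  move: E; rewrite modn_small // => E; apply/orP; left; apply/eqP/val_inj.
  by rewrite /= -E doubleK inordK.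
apply/orP; right; apply/eqP/val_inj.
have -> : (u + m.+1)%N = s.*2.
  rewrite -E -{1}(subnK sl) modnDr modn_small ?subnK //; lia.
by rewrite /= doubleK inordK.
Qed.

(** One representative of each pair [t], [-t] of distinct residues: a sum of two members is positive
    and does not wrap around. *)
Definition half_Zp m : {set 'I_m.+1} := [set t : 'I_m.+1 | (0 < t)%N && (t.*2 < m.+1)%N].

Lemma half_Zp_neq1 m : {in half_Zp m, forall t, t != 1%g}.
Proof. by move=> t; rewrite inE => /andP[t0 _]; apply: contraTneq t0 => ->. Qed.

Lemma half_Zp_mul_neq1 m : {in half_Zp m &, forall t t', (t * t' != 1)%g}.
Proof.
move=> t t'; rewrite !inE => /andP[t0 tm] /andP[_ tm'].
apply/eqP => /(congr1 val) /=; rewrite modn_small; lia.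
Qed.

Lemma card_half_Zp m : (2 <= m)%N -> (m.+1 <= 4 * #|half_Zp m|)%N.
Proof.
move=> m2; pose f (i : 'I_(m./2)) : 'I_m.+1 := inord i.+1.
have fE i : f i = i.+1 :> nat.
  by rewrite inordK //; have := ltn_ord i; lia.
have finj : injective f by move=> i j /(congr1 val) /=; rewrite !fE => -[] /val_inj.
suff : (m./2 <= #|half_Zp m|)%N by lia.
rewrite -[m./2]card_ord -(card_imset _ finj); apply: subset_leq_card.
by apply/subsetP => _ /imsetP[i _ ->]; rewrite inE fE; have := ltn_ord i; lia.
Qed.

Section CyclicOrder.
Context (R : realType) (c : R) (n : nat).
Hypothesis hc : 1 / 4 <= c < 1 / 2.
Local Notation F := (n`!%:R : R).
Local Notation M := ((cyc_order c n)%:R : R).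

Lemma cyc_order_ge_fact : (n`! <= cyc_order c n)%N.
Proof.
have h := hc; rewrite /cyc_order truncn_ge_nat ?powR_ge0 //; apply: le1r_powR.
  by rewrite ler1n fact_gt0.
by rewrite ler_pdivlMr; lra.
Qed.

Lemma cyc_order_gt0 : (0 < cyc_order c n)%N.
Proof. exact: leq_trans (fact_gt0 n) cyc_order_ge_fact. Qed.

(** The exponent is chosen for this: [(1 - 2 c) ln M <= 2 c ln F] rearranges to
    [M <= (F M)^(2 c)]. *)
Lemma ln_cyc_order_le : ln M <= 2 * c * ln (F * M).
Proof.
have h := hc; have F0 : 0 < F by rewrite ltr0n fact_gt0.
have M0 : 0 < M by rewrite ltr0n cyc_order_gt0.
rewrite lnM ?posrE //.
have : M <= F `^ (2 * c / (1 - 2 * c)) by rewrite truncn_le powR_ge0.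
rewrite -ler_ln ?posrE ?powR_gt0 // ln_powR [_ / _ * ln _]mulrAC ler_pdivlMr; last lra.
lra.
Qed.

(** Rounding down loses at most a factor 2, because the power is at most [M + 1 <= 2 M]. *)
Lemma ln_cyc_order_ge : 2 * c * ln (F * M) - ln 2 <= ln M.
Proof.
have h := hc; have F0 : 0 < F by rewrite ltr0n fact_gt0.
have M0 : 0 < M by rewrite ltr0n cyc_order_gt0.
have M1 : 1 <= M by rewrite ler1n cyc_order_gt0.
rewrite lnM ?posrE //.
have l2 : 0 <= ln 2 :> R by rewrite ln_ge0 // ler1n.
have : F `^ (2 * c / (1 - 2 * c)) <= 2 * M.
  have /andP[_ /ltW] := truncn_itv (powR_ge0 F (2 * c / (1 - 2 * c))).
  by rewrite -natr1 -/(cyc_order c n); lra.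
have M20 : 0 < 2 * M by lra.
rewrite -ler_ln ?posrE ?powR_gt0 // ln_powR lnM ?posrE //.
rewrite [_ / _ * ln _]mulrAC ler_pdivrMr; last lra.
nra.
Qed.

Lemma card_sym_cyc : #|{: sym_cyc c n}| = (n`! * cyc_order c n)%N.
Proof. by rewrite card_prod card_Sn card_ord prednK // cyc_order_gt0. Qed.

End CyclicOrder.

(** * Numerical estimates *)

Section Numerics.
Context {R : realType}.
Implicit Types (c eps tol N M F L q r y a b : R).

(** The fourth power of [x <= 4 expR (x / 4)] at [x = ln N]. *)
Lemma ln_pow4_le N : 1 <= N -> ln N ^+ 4 <= 256 * N.
Proof.
move=> N1; have N0 : 0 < N by lra.
have L0 : 0 <= ln N by rewrite ln_ge0.
have -> : 256 * N = (4 * expR (ln N / 4)) ^+ 4.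
  rewrite exprMn -expRM_natl (_ : 4%:R * (ln N / 4) = ln N); last by field.
  by rewrite lnK ?posrE //; ring.
apply: lerXn2r; rewrite ?nnegrE ?mulr_ge0 ?expR_ge0 //.
have := expR_ge1Dx (ln N / 4); lra.
Qed.

Lemma cube_ratio a b L N : 0 <= b -> 0 <= L -> L ^+ 4 <= 256 * N ->
  256 * a <= b * L -> a * L ^+ 3 <= b * N.
Proof.
move=> b0 L0 LN ab; have L3 : 0 <= L ^+ 3 by rewrite exprn_ge0.
have := ler_wpM2r L3 ab; have := ler_wpM2l b0 LN; rewrite (exprS L 3); lra.
Qed.

Lemma expRN_le_inv a : 0 < a -> expR (- a) <= a^-1.
Proof.
move=> a0; rewrite expRN lef_pV2 ?posrE ?expR_gt0 //.
by have := expR_ge1Dx a; lra.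
Qed.

Lemma expR_le_1D2 a : 0 <= a -> a <= 1 / 2 -> expR a <= 1 + 2 * a.
Proof.
move=> a0 a2; have := expR_ge1Dx (- a); rewrite expRN => H.
have E0 := expR_gt0 a; have : (1 - a) * expR a <= 1 by rewrite -ler_pdivlMr // div1r.
nra.
Qed.

Lemma sqr_ler_le a b : 0 <= b -> a ^+ 2 <= b ^+ 2 -> a <= b.
Proof.
move=> b0 ab; have [a0|a0] := leP 0 a; last by lra.
by rewrite -(@ler_pXn2r _ 2) ?nnegrE.
Qed.

Lemma ge_sqr16_of_le F M N L : 0 <= F -> F <= M -> N = F * M -> L ^+ 4 <= 256 * N ->
  L ^+ 2 <= 16 * M.
Proof.
move=> F0 FM NE LN; apply: sqr_ler_le; first lra.
have : F * M <= M * M by rewrite ler_wpM2r //; lra.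
rewrite -exprM; lra.
Qed.

(** [theta] is the relative loss allowed in the exponent: [16 q] takes half of it, [1/r] and [10/M]
    a quarter each, and [(c + eps) (1 - theta) = c + eps / 2]. Then [2 expR (- y)] is at most
    [tol / 2], and the remaining terms are at most [6 expR (- (eps L))], again at most [tol / 2]. *)
Lemma upper_numerics c eps tol N M F L r q theta : 0 < c -> 1 / 4 <= c -> 0 < eps ->
  1 <= F -> F <= M -> N = F * M -> L = ln N ->
  ln M <= 2 * c * L -> 2 * c * L - ln 2 <= ln M ->
  theta = eps / (2 * (c + eps)) -> q = Num.sqrt ((c + eps) * (L / N)) ->
  16 <= L -> 256 * (c + eps) <= (theta / 32) ^+ 2 * L -> 40 <= theta * L ->
  0 < r -> 4 <= theta * r -> 4 <= tol * (c * L) -> 12 <= tol * (eps * L) ->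
  16 * q <= 1 /\
  forall y, y = q ^+ 2 * (1 - 16 * q) * (N * (1 - (r^-1 + 10 / M))) ->
  2 * expR (- y) + (M + 2 * F) * expR (- (2 * y)) + N * expR (- (4 * y)) <= tol.
Proof.
move=> c0 c4 eps0 F1 FM NE LE lnM_le lnM_ge thetaE qE L16 h1 h2 r0 hr h3 h4.
have M0 : 0 < M by lra. have F0 : 0 < F by lra.
have N0 : 0 < N by rewrite NE mulr_gt0.
have N1 : 1 <= N by rewrite NE -[leLHS]mulr1 ler_pM //; lra.
have L4 : L ^+ 4 <= 256 * N by rewrite LE ln_pow4_le.
have ce0 : 0 < 2 * (c + eps) by lra.
have theta0 : 0 < theta by rewrite thetaE divr_gt0.
have thetaM : theta * (2 * (c + eps)) = eps by rewrite thetaE divfK // gt_eqF.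
have theta1 : theta <= 1 by nra.
have q0 : 0 <= q by rewrite qE sqrtr_ge0.
have q2N : q ^+ 2 * N = (c + eps) * L.
  rewrite qE sqr_sqrtr; last by rewrite mulr_ge0 ?divr_ge0 //; lra.
  by field; rewrite gt_eqF.
have q_le : q <= theta / 32.
  apply: sqr_ler_le; first by rewrite divr_ge0 // ltW.
  rewrite -(ler_pM2r N0) q2N.
  apply: le_trans (cube_ratio (sqr_ge0 _) _ L4 h1); last lra.
  rewrite ler_wpM2l //; first lra.
  by rewrite -[leLHS]expr1 ler_weXn2l //; lra.
have ML : L <= M.
  have := ge_sqr16_of_le (ltW F0) FM NE L4; rewrite expr2; nra.
split; first lra.
move=> y yE.
have rV : r^-1 <= theta / 4.
  by rewrite -(ler_pM2l r0) divff ?gt_eqF //; lra.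
have MV : 10 / M <= theta / 4.
  rewrite ler_pdivrMr //; have := ler_wpM2l (ltW theta0) ML; lra.
have rV0 : 0 < r^-1 by rewrite invr_gt0.
have MV0 : 0 < 10 / M by rewrite divr_gt0.
have y_ge : (c + eps / 2) * L <= y.
  have -> : y = (c + eps) * L * ((1 - 16 * q) * (1 - (r^-1 + 10 / M))).
    by rewrite yE -q2N; ring.
  have : 1 - theta <= (1 - 16 * q) * (1 - (r^-1 + 10 / M)).
    have : 0 <= 16 * q * (r^-1 + 10 / M) by rewrite !mulr_ge0 ?addr_ge0 //; lra.
    lra.
  have cL0 : 0 <= (c + eps) * L by rewrite mulr_ge0; lra.
  move=> /(ler_wpM2l cL0); apply: le_trans.
  have -> : (c + eps) * L * (1 - theta) =
    (c + eps) * L - theta * (2 * (c + eps)) * L / 2 by field.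
  by rewrite thetaM; lra.
have cL : 0 <= c * L by rewrite mulr_ge0; lra.
have cL4 : 1 / 4 * L <= c * L by rewrite ler_wpM2r //; lra.
have eL0 : 0 < eps * L by rewrite mulr_gt0 //; lra.
have cLp : 0 < c * L by lra.
have E1 : 2 * expR (- y) <= tol / 2.
  have : expR (- y) <= (c * L)^-1.
    by apply: le_trans (expRN_le_inv cLp); rewrite ler_expR; lra.
  have : (c * L)^-1 <= tol / 4 by rewrite -(ler_pM2r cLp) mulVf ?gt_eqF //; lra.
  lra.
have E2 : expR (- (eps * L)) <= tol / 12.
  apply: le_trans (expRN_le_inv eL0) _.
  by rewrite -(ler_pM2r eL0) mulVf ?gt_eqF //; lra.
have lnN : L = ln F + ln M by rewrite LE NE lnM ?posrE.
have E3 : M * expR (- (2 * y)) <= expR (- (eps * L)).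
  by rewrite -{1}[M]lnK ?posrE // -expRD ler_expR; lra.
(* Here and in [E5] the hypothesis [1/4 <= c] enters: [F] is at most [2 expR ((1 - 2 c) L)] and [N]
   is [expR L], while [1 - 4 c <= 0]. *)
have E4 : F * expR (- (2 * y)) <= 2 * expR (- (eps * L)).
  rewrite -{1}[F]lnK ?posrE // -[X in X * _ <= _]/(expR _) -{2}[2]lnK ?posrE //.
  by rewrite -!expRD ler_expR; lra.
have E5 : N * expR (- (4 * y)) <= expR (- (eps * L)).
  by rewrite -{1}[N]lnK ?posrE // -LE -expRD ler_expR; lra.
lra.
Qed.

(** Loops cost at most [eps L / 2] in the exponent and edges at most [2 (c - eps) L + eps L / 2], in
    total [2 c L - eps L]. Since [j >= M / 4 >= expR (2 c L) / 8], the expected number is at least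
    [expR (eps L) / 8]. *)
Lemma lower_numerics c eps tol N M F L q j rho : c < 1 / 2 -> 0 < eps -> eps < c ->
  0 < tol -> tol <= 1 -> 1 <= F -> F <= M -> N = F * M -> L = ln N ->
  2 * c * L - ln 2 <= ln M -> M <= 4 * j ->
  0 <= q -> q <= Num.sqrt ((c - eps) * (L / N)) ->
  rho = tol / 16 / 256 ->
  256 <= L / 256 -> 576 <= eps ^+ 2 * L -> 256 <= eps / 32 * L -> 16 <= tol * (eps * L) ->
  256 <= rho ^+ 2 * L -> 8 <= rho * L ->
  [/\ 16 * q <= 1,
      eps * L / 8 <= j * expR (- (q / (1 - q) * (4 * F + 2) +
                               2 * (q ^+ 2 / (1 - 8 * q ^+ 2)) * N)) &
      (eps * L / 8)^-1 +
        (expR (256 * q ^+ 3 * N + 32 * q ^+ 2 * (16 * F + 4) + 8 * q) - 1) <= tol].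
Proof.
move=> c2 eps0 epsc tol0 tol1 F1 FM NE LE lnM_ge Mj q0 qle rhoE hL h1 h2 h3 h4 h5.
have M0 : 0 < M by lra. have F0 : 0 < F by lra.
have N0 : 0 < N by rewrite NE mulr_gt0.
have N1 : 1 <= N by rewrite NE -[leLHS]mulr1 ler_pM //; lra.
have L4 : L ^+ 4 <= 256 * N by rewrite LE ln_pow4_le.
have L0 : 0 < L by lra.
have rho0 : 0 < rho by lra.
pose c' := c - eps; have c'0 : 0 < c' by rewrite /c'; lra.
have c'1 : c' <= 1 / 2 by rewrite /c'; lra.
have qq : 0 <= q ^+ 2 by rewrite sqr_ge0.
have q2N : q ^+ 2 * N <= c' * L.
  rewrite -ler_pdivlMr // -mulrA -(@sqr_sqrtr _ (c' * (L / N))); last first.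
    by rewrite mulr_ge0 ?divr_ge0 //; lra.
  by apply: lerXn2r; rewrite ?nnegrE ?sqrtr_ge0.
have LL3 : L <= L ^+ 3 by rewrite -[leLHS]expr1 ler_weXn2l //; lra.
have q2_le b : 0 <= b -> 256 <= b * L -> q ^+ 2 <= b.
  move=> b0 hb; rewrite -(ler_pM2r N0); apply: le_trans q2N _.
  have : 256 * c' <= b * L by lra.
  move=> /(cube_ratio b0 (ltW L0) L4); apply: le_trans.
  by rewrite ler_wpM2l // ltW.
have q2s : q ^+ 2 <= 1 / 256 by apply: q2_le; lra.
have q16 : q <= 1 / 16 by apply: sqr_ler_le; lra.
have q2e : q ^+ 2 <= eps / 32 by apply: q2_le; lra.
have qL : q * L <= rho.
  apply: sqr_ler_le; first exact: ltW.
  have h4' : 256 * c' <= rho ^+ 2 * L by lra.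
  have := cube_ratio (sqr_ge0 rho) (ltW L0) L4 h4' => H.
  rewrite -(ler_pM2r N0); apply: le_trans H.
  have := ler_wpM2r (sqr_ge0 L) q2N.
  by rewrite exprMn (exprS L 2); lra.
have L2M := ge_sqr16_of_le (ltW F0) FM NE L4.
have L1 : 1 <= L by lra.
clear hL h2 h4 L4 q2_le q2s; split; first lra.
  have X1 : q / (1 - q) * (4 * F + 2) <= eps * L / 2.
    have qF : q * F <= eps * L / 24.
      apply: sqr_ler_le; first by rewrite !mulr_ge0 //; lra.
      have : (q * F) ^+ 2 <= q ^+ 2 * N.
        by rewrite exprMn NE ler_wpM2l // expr2 ler_wpM2l //; lra.
      have : 576 * (c' * L) <= (eps * L) ^+ 2.
        have := ler_wpM2r (ltW L0) h1.
        have : c' * L <= 1 * L by rewrite ler_wpM2r //; lra.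
        by rewrite exprMn expr2; lra.
      by rewrite expr_div_n; lra.
    have : q / (1 - q) <= 2 * q.
      rewrite ler_pdivrMr; last lra.
      by nra.
    have F6 : 0 <= 4 * F + 2 by lra.
    move=> /(ler_wpM2r F6) H.
    have qF1 : q <= q * F by rewrite ler_peMr.
    lra.
  have X2 : 2 * (q ^+ 2 / (1 - 8 * q ^+ 2)) * N <= 2 * c' * L + eps * L / 2.
    have : q ^+ 2 / (1 - 8 * q ^+ 2) <= q ^+ 2 * (1 + 16 * q ^+ 2).
      rewrite ler_wpM2l // -div1r ler_pdivrMr; nra.
    move=> /(ler_wpM2r (ltW N0)) H.
    have : (1 + 16 * q ^+ 2) * (q ^+ 2 * N) <= (1 + 16 * q ^+ 2) * (c' * L).
      by rewrite ler_wpM2l //; lra.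
    have : q ^+ 2 * (c' * L) <= eps / 32 * (c' * L).
      by rewrite ler_wpM2r // mulr_ge0 // ltW.
    have : c' * (eps * L) <= 1 / 2 * (eps * L).
      by rewrite ler_wpM2r // mulr_ge0 // ltW.
    lra.
  have l2 : 0 < 2 :> R by lra.
  have ME : expR (2 * c * L) / 2 <= M.
    rewrite -[X in _ / X](lnK l2) -expRN -expRD -[leRHS]lnK ?posrE // ler_expR; lra.
  set X := q / _ * _ + _.
  have HX : expR (- (2 * c * L - eps * L)) <= expR (- X).
    by rewrite ler_expR lerN2 /X; rewrite /c' in X2; lra.
  have H1 : eps * L <= expR (eps * L) by have := expR_ge1Dx (eps * L); lra.
  have H2 : expR (2 * c * L) * expR (- (2 * c * L - eps * L)) = expR (eps * L).
    by rewrite -expRD; congr expR; ring.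
  have H3 : expR (2 * c * L) / 8 * expR (- (2 * c * L - eps * L)) <= j * expR (- X).
    by apply: ler_pM; rewrite ?divr_ge0 ?expR_ge0 //; lra.
  lra.
have eL0 : 0 < eps * L by rewrite mulr_gt0.
have A1 : (eps * L / 8)^-1 <= tol / 2.
  rewrite -(@ler_pM2r _ (eps * L / 8)) ?divr_gt0 // mulVf ?gt_eqF ?divr_gt0 //.
  lra.
set h := 256 * _ * _ + _ + _.
have h0 : 0 <= h.
  by rewrite /h !addr_ge0 ?mulr_ge0 ?exprn_ge0 //; lra.
(* [rho] is [tol / 4096], small enough that the multiples 256, 512, 128 and 8 of the bounds [B1] to
   [B4] add up to less than [tol / 4]; then [expR h - 1 <= tol / 2]. *)
have hle : h <= tol / 4.
  have B1 : q ^+ 3 * N <= rho.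
    have := ler_wpM2l q0 q2N.
    have : c' * (q * L) <= 1 * (q * L) by rewrite ler_wpM2r ?mulr_ge0 //; lra.
    rewrite (exprS q 2); lra.
  have B2 : q ^+ 2 * F <= rho.
    have H : q ^+ 2 * F * L ^+ 2 <= 8 * L.
      have qF0 : 0 <= q ^+ 2 * F by rewrite mulr_ge0 // ltW.
      have := ler_wpM2l qF0 L2M; move: q2N; rewrite NE.
      have : c' * L <= 1 / 2 * L by rewrite ler_wpM2r // ltW.
      lra.
    have LL0 : 0 < L ^+ 2 by rewrite exprn_gt0.
    rewrite -(ler_pM2r LL0); apply: le_trans H _.
    have := ler_wpM2r (ltW L0) h5; rewrite expr2; lra.
  have B3 : q <= rho.
    apply: le_trans qL; rewrite ler_peMr //; lra.
  have B4 : q ^+ 2 * 4 <= q ^+ 2 * (4 * F) by rewrite ler_wpM2l //; lra.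
  rewrite /h; lra.
have := expR_le_1D2 h0; lra.
Qed.

End Numerics.

(** * Both regimes for the symmetric times cyclic groups *)

Section Asymptotics.
Context (R : realType) (c : R).
Hypothesis hc : 1 / 4 <= c < 1 / 2.

Lemma card_sym_cyc_ge k : (k <= #|sym_cyc c k|)%N.
Proof.
rewrite (card_sym_cyc k hc); apply: leq_trans (fact_geq k) _.
by rewrite leq_pmulr // cyc_order_gt0.
Qed.

Lemma near_card_sym_cyc (A : R) : \forall k \near \oo%classic, A <= #|sym_cyc c k|%:R.
Proof.
have := @nbhs_infty_ger R A; apply: filterS => k /le_trans; apply.
by rewrite ler_nat card_sym_cyc_ge.
Qed.

Lemma near_ln_card_sym_cyc (a A : R) : 0 < a ->
  \forall k \near \oo%classic, A <= a * ln #|sym_cyc c k|%:R.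
Proof.
move=> a0; have := near_card_sym_cyc (expR (A / a)); apply: filterS => k H.
rewrite mulrC -ler_pdivrMr // -[leLHS]expRK ler_ln ?posrE ?expR_gt0 //.
exact: lt_le_trans (expR_gt0 _) H.
Qed.

Lemma near_natr_pred (a A : R) : 0 < a -> \forall k \near \oo%classic, A <= a * (k.-1)%:R.
Proof.
move=> a0; have := @nbhs_infty_ger R (A / a + 1); apply: filterS => -[|k] /= H.
  have : A / a <= -1 by lra.
  by rewrite ler_pdivrMr //; lra.
by rewrite mulrC -ler_pdivrMr //; move: H; rewrite -natr1; lra.
Qed.

Local Notation N k := (#|sym_cyc c k|%:R : R).

Lemma natr_card_sym_cyc k : N k = k`!%:R * (cyc_order c k)%:R.
Proof. by rewrite (card_sym_cyc k hc) natrM. Qed.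

Lemma prob_diameter_gt2_sym_cyc_ge (eps tol rho q : R) k :
  0 < eps -> eps < c -> 0 < tol -> tol <= 1 -> rho = tol / 16 / 256 -> (2 < k)%N ->
  0 <= q -> q <= Num.sqrt ((c - eps) * (ln (N k) / N k)) ->
  256 <= ln (N k) / 256 -> 576 <= eps ^+ 2 * ln (N k) ->
  256 <= eps / 32 * ln (N k) -> 16 <= tol * (eps * ln (N k)) ->
  256 <= rho ^+ 2 * ln (N k) -> 8 <= rho * ln (N k) ->
  1 - tol <= random_subset_prob q
    (fun S : {set sym_cyc c k} => 2%:E < diameter R (cayley S))%E.
Proof.
move=> eps0 epsc tol0 tol1 rhoE k2 q0 qle h0 h1 h2 h3 h4 h5.
have c2 : c < 1 / 2 by case/andP: hc.
(* The cyclic factor is ['I_m.-1.+1], so the condition of [card_half_Zp] reads [3 <= m]; this is why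
   [2 < k] is assumed. *)
have m2 : (2 <= (cyc_order c k).-1)%N.
  rewrite ltn_predRL (leq_trans k2) // (leq_trans (fact_geq k)) //.
  exact: cyc_order_ge_fact.
have F1 : 1 <= k`!%:R :> R by rewrite ler1n fact_gt0.
have FM : k`!%:R <= (cyc_order c k)%:R :> R by rewrite ler_nat cyc_order_ge_fact.
have Mj : (cyc_order c k)%:R <= 4 * #|half_Zp (cyc_order c k).-1|%:R :> R.
  by rewrite -natrM ler_nat -{1}(prednK (cyc_order_gt0 k hc)) card_half_Zp.
have lnM_ge : 2 * c * ln (N k) - ln 2 <= ln (cyc_order c k)%:R.
  by rewrite natr_card_sym_cyc ln_cyc_order_ge.
have [q16 lo_le tol_ge] := lower_numerics c2 eps0 epsc tol0 tol1 F1 FM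
  (natr_card_sym_cyc k) erefl lnM_ge Mj q0 qle rhoE h0 h1 h2 h3 h4 h5.
have lo0 : 0 < eps * ln (N k) / 8.
  rewrite divr_gt0 // -(pmulr_rgt0 _ tol0); apply: lt_le_trans h3.
  by rewrite ltr0n.
have := @prob_diameter_gt2_central_ge R 'S_k 'I_(cyc_order c k).-1.+1 (@Zp_addC _)
  (@card_sqrt_Zp_le2 _) (half_Zp (cyc_order c k).-1) q _ q0 q16 (@half_Zp_neq1 _)
  (fun t t' tJ t'J _ => half_Zp_mul_neq1 tJ t'J) lo0.
rewrite card_Sn => /(_ lo_le); apply: le_trans.
by rewrite lerD2l lerN2.
Qed.

Lemma prob_diameter_le2_sym_cyc_ge (eps tol theta p : R) k :
  0 < eps -> theta = eps / (2 * (c + eps)) -> (1 < k)%N -> p <= 1 ->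
  Num.sqrt ((c + eps) * (ln (N k) / N k)) <= p ->
  16 <= ln (N k) -> 256 * (c + eps) <= (theta / 32) ^+ 2 * ln (N k) ->
  40 <= theta * ln (N k) -> 4 <= theta * (k.-1)%:R ->
  4 <= tol * (c * ln (N k)) -> 12 <= tol * (eps * ln (N k)) ->
  1 - tol <= random_subset_prob p
    (fun S : {set sym_cyc c k} => diameter R (cayley S) <= 2%:E)%E.
Proof.
move=> eps0 thetaE k1 p1 qp h0 h1 h2 h3 h4 h5.
have c4 : 1 / 4 <= c by case/andP: hc.
have c0 : 0 < c by apply: lt_le_trans c4; rewrite divr_gt0.
have F1 : 1 <= k`!%:R :> R by rewrite ler1n fact_gt0.
have FM : k`!%:R <= (cyc_order c k)%:R :> R by rewrite ler_nat cyc_order_ge_fact.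
have lnM_le : ln (cyc_order c k)%:R <= 2 * c * ln (N k).
  by rewrite natr_card_sym_cyc ln_cyc_order_le.
have lnM_ge : 2 * c * ln (N k) - ln 2 <= ln (cyc_order c k)%:R.
  by rewrite natr_card_sym_cyc ln_cyc_order_ge.
have r0 : (0 < k.-1)%N by rewrite ltn_predRL.
have rr0 : 0 < (k.-1)%:R :> R by rewrite ltr0n.
have [q16 sum_le] := upper_numerics c0 c4 eps0 F1 FM (natr_card_sym_cyc k) erefl lnM_le
  lnM_ge thetaE erefl h0 h1 h2 rr0 h3 h4 h5.
apply: le_trans (prob_diameter_le2_ge (sym_cyc c k) (sqrtr_ge0 _) qp p1).
rewrite lerD2l lerN2.
have := @sum_indep_prob_factor_rel_le R 'S_k 'I_(cyc_order c k).-1.+1 (@Zp_addC _)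
  (@card_sqrt_Zp_le2 _) _ k.-1 r0 (@card_cent_perm_le k) (sqrtr_ge0 _) q16 _ erefl.
move=> /le_trans; apply.
rewrite card_Sn card_ord prednK; last exact: cyc_order_gt0.
exact: sum_le.
Qed.

End Asymptotics.

Theorem theorem1p2 (R : realType) (c : R) (hc : 1 / 4 <= c < 1 / 2) :
  diameter2_threshold (sym_cyc c) c.
Proof.
have c0 : 0 < c by lra.
rewrite /diameter2_threshold; split => //.
  by apply/cvgryPge => A; apply: near_card_sym_cyc.
move=> eps0 eps00 p p01.
have normP (E : forall k, pred {set sym_cyc c k}) (tol tol' : R) k : tol <= tol' ->
    1 - tol <= random_subset_prob (p k) (E k) ->
    `|1 - random_subset_prob (p k) (E k)| <= tol'.
  move=> tt' H; rewrite ger0_norm; last by rewrite subr_ge0 random_subset_prob_le1.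
  by rewrite lerBlDl -lerBlDr; apply: le_trans H; rewrite lerD2l lerN2.
split=> hp; apply/cvgrPdist_le => tol0 tol00.
  (* Shrinking [eps] only weakens the upper bound on [p], and it makes [c - eps] positive even when
     [eps0] exceeds [c]. *)
  pose tol := Num.min tol0 1; pose eps := Num.min eps0 (c / 2).
  have tolP : 0 < tol by rewrite lt_min tol00 ltr01.
  have tol1 : tol <= 1 by rewrite ge_min lexx orbT.
  have tolle : tol <= tol0 by rewrite ge_min lexx.
  have epsP : 0 < eps by rewrite lt_min eps00 divr_gt0.
  have epsc : eps < c.
    by have : eps <= c / 2; [rewrite ge_min lexx orbT | lra].
  have epsle : eps <= eps0 by rewrite ge_min lexx.
  pose rho := tol / 16 / 256; have rhoP : 0 < rho by rewrite /rho; lra.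
  have L (a A : R) : 0 < a -> \forall k \near \oo%classic, A <= a * ln #|sym_cyc c k|%:R.
    by move=> a0; apply: (near_ln_card_sym_cyc hc).
  have e2 : 0 < eps ^+ 2 by rewrite exprn_gt0.
  have e32 : 0 < eps / 32 by lra.
  have te : 0 < tol * eps by rewrite mulr_gt0.
  have rho2 : 0 < rho ^+ 2 by rewrite exprn_gt0.
  have V0 : 0 < 256^-1 :> R by rewrite invr_gt0.
  apply: filterS (filterI hp (filterI (nbhs_infty_ge 3) (filterI (L _ 256 V0)
    (filterI (L _ 576 e2) (filterI (L _ 256 e32) (filterI (L _ 16 te)
    (filterI (L _ 256 rho2) (L _ 8 rhoP)))))))).
  move=> k [pk [k3 [h0 [h1 [h2 [h3 [h4 h5]]]]]]].
  apply: (@normP (fun k S => 2%:E < diameter R (cayley S))%E _ _ _ tolle).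
  have /andP[pk0 pk1] := p01 k.
  apply: (@prob_diameter_gt2_sym_cyc_ge R c hc eps tol rho (p k) k) => //.
  - apply: le_trans pk _; apply: ler_wsqrtr; apply: ler_wpM2r; last by rewrite lerD2l lerN2.
    rewrite divr_ge0 // ln_ge0 // ler1n; apply: leq_trans (card_sym_cyc_ge hc k).
    exact: leq_trans k3.
  - by rewrite mulrC.
  - by rewrite mulrA.
pose theta := eps0 / (2 * (c + eps0)).
have theta0 : 0 < theta by rewrite divr_gt0 // mulr_gt0 //; lra.
have L (a A : R) : 0 < a -> \forall k \near \oo%classic, A <= a * ln #|sym_cyc c k|%:R.
  by move=> a0; apply: (near_ln_card_sym_cyc hc).
have th2 : 0 < (theta / 32) ^+ 2 by rewrite exprn_gt0 // divr_gt0.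
have tc : 0 < tol0 * c by rewrite mulr_gt0.
have te : 0 < tol0 * eps0 by rewrite mulr_gt0.
apply: filterS (filterI hp (filterI (nbhs_infty_ge 2) (filterI (L _ 16 ltr01)
  (filterI (L _ (256 * (c + eps0)) th2) (filterI (L _ 40 theta0)
  (filterI (near_natr_pred 4 theta0)
  (filterI (L _ 4 tc) (L _ 12 te)))))))).
move=> k [pk [k2 [h0 [h1 [h2 [h3 [h4 h5]]]]]]].
apply: (@normP (fun k S => diameter R (cayley S) <= 2%:E)%E _ _ _ (lexx tol0)).
have /andP[pk0 pk1] := p01 k.
apply: (@prob_diameter_le2_sym_cyc_ge R c hc eps0 tol0 theta (p k) k) => //.
- by rewrite -[leRHS]mul1r.
- by rewrite mulrA.
- by rewrite mulrA.
Qed.
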